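(* Let $\mathfrak g_8=(e^{16}-e^{25},e^{15}+e^{26},-e^{36}+e^{45},-e^{35}-e^{46},0,0)$ and let $J$ be any complex structure on $\mathfrak g_8$ with non-zero closed $(3,0)$-form. Then there is a $(1,0)$-basis $\{\omega^1,\omega^2,\omega^3\}$ satisfying one of the following reduced equations: (a) $(\mathfrak g_8,J)$: $d\omega^1=2i\,\omega^{13}+\omega^{3\bar3}$, $d\omega^2=-2i\,\omega^{23}$, $d\omega^3=0$; (b) $(\mathfrak g_8,J')$: $d\omega^1=2i\,\omega^{13}+\omega^{3\bar3}$, $d\omega^2=-2i\,\omega^{23}+\omega^{3\bar3}$, $d\omega^3=0$; (c) $(\mathfrak g_8,J_A)$: $d\omega^1=-(A-i)\omega^{13}-(A+i)\omega^{1\bar3}$, $d\omega^2=(A-i)\omega^{23}+(A+i)\omega^{2\bar3}$, $d\omega^3=0$, where $A\in\mathbb C$ with $\operatorname{Im}A\neq0$. Moreover, the complex structures above are (pairwise) non-isomorphic.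
   Context: The notation $(\epsilon_1,\dots,\epsilon_6)$ denotes the real Lie algebra whose dual has a basis $\{e^1,\dots,e^6\}$ with $de^i=\epsilon_i$ ($d$ the Chevalley–Eilenberg differential, $e^{ij}=e^i\wedge e^j$). A complex structure on $\mathfrak g$ is an endomorphism $J$ with $J^2=-I$ and vanishing Nijenhuis tensor; a complex $1$-form $\eta$ is of type $(1,0)$ if $\eta\circ J=i\eta$. Two complex structures $J,J'$ on $\mathfrak g$ are isomorphic (equivalent) if there is an automorphism $F$ of $\mathfrak g$ with $F\circ J=J'\circ F$. Write $\omega^{jk}=\omega^j\wedge\omega^k$ and $\omega^{j\bar k}=\omega^j\wedge\overline{\omega^k}$. *)

(* Defs.v *)
From HB Require Import structures.
From mathcomp Require Import all_boot all_order all_algebra.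
From mathcomp Require Import complex.
From mathcomp Require Import reals.
From mathcomp Require Import ring.

Set Implicit Arguments.
Unset Strict Implicit.
Unset Printing Implicit Defensive.

Import GRing.Theory Num.Theory.
Local Open Scope ring_scope.
Local Open Scope complex_scope.

HB.mixin Record Vector_isLieAlgebra (K : fieldType) (g : Type)
    of Vector K g := {
  lie : g -> g -> g;
  lie_linearl : forall (a : K) (x y z : g),
    lie (a *: x + y) z = a *: lie x z + lie y z;
  lie_linearr : forall (a : K) (x y z : g),
    lie z (a *: x + y) = a *: lie z x + lie z y;
  lie_alt : forall x : g, lie x x = 0;
  lie_jacobi : forall x y z : g,
    lie x (lie y z) + lie y (lie z x) + lie z (lie x y) = 0
}.

#[short(type="lieAlgType")]
HB.structure Definition LieAlgebra (K : fieldType) :=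
  { g of Vector_isLieAlgebra K g & Vector K g }.

(* Left-invariant forms are alternating multilinear maps; [wedge] and the
   Chevalley-Eilenberg differentials below use the same normalization (no
   factorials: [(a /\ b)(x, y) = a x * b y - a y * b x]). *)
Definition wedge (g : Type) (S : comNzRingType) (a b : g -> S) : g -> g -> S :=
  fun x y => a x * b y - a y * b x.

Definition ce_d1 (K : fieldType) (g : lieAlgType K) (S : comNzRingType)
    (a : g -> S) : g -> g -> S :=
  fun x y => - a (lie x y).

(* [d psi (x_0, .., x_3) = \sum_(i < j) (-1)^(i + j)
     psi ([x_i, x_j], x_0, .., ^x_i, .., ^x_j, .., x_3)] *)
Definition ce_d3 (K : fieldType) (g : lieAlgType K) (S : comNzRingType)
    (psi : g -> g -> g -> S) : g -> g -> g -> g -> S :=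
  fun x0 x1 x2 x3 =>
    - psi (lie x0 x1) x2 x3 + psi (lie x0 x2) x1 x3 - psi (lie x0 x3) x1 x2
    - psi (lie x1 x2) x0 x3 + psi (lie x1 x3) x0 x2 - psi (lie x2 x3) x0 x1.

Section ComplexStructures.
Variables (R : realType) (g : lieAlgType R).
Implicit Types (J : 'End(g)) (a w : g -> R[i]) (psi : g -> g -> g -> R[i]).

(* Elements of the complexified dual of [g]: real-linear maps [g -> R[i]]. *)
Definition cform1 a : Prop :=
  forall (c : R) (x y : g), a (c *: x + y) = c%:C * a x + a y.

Definition cform3 psi : Prop :=
  [/\ forall y z, cform1 (fun x => psi x y z),
      forall x z, cform1 (fun y => psi x y z),
      forall x y, cform1 (fun z => psi x y z),
      forall x y, psi x x y = 0 &
      forall x y, psi x y y = 0].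

Definition nijenhuis J (x y : g) : g :=
  lie x y + J (lie (J x) y) + J (lie x (J y)) - lie (J x) (J y).

Definition complex_structure J : Prop :=
  (forall x, J (J x) = - x) /\ (forall x y, nijenhuis J x y = 0).

Definition form10 J a : Prop := cform1 a /\ forall x, a (J x) = 'i%C * a x.

(* By alternation it is enough to test the type on the first argument. *)
Definition form30 J psi : Prop :=
  cform3 psi /\ forall x y z, psi (J x) y z = 'i%C * psi x y z.

Definition has_closed_volume_form J : Prop :=
  exists psi, [/\ form30 J psi,
    exists x y z, psi x y z != 0 &
    forall x0 x1 x2 x3, ce_d3 psi x0 x1 x2 x3 = 0].

(* [w1, w2, w3] is a basis over [R[i]] of the space of (1,0)-forms. *)
Definition basis10 J w1 w2 w3 : Prop :=
  [/\ form10 J w1, form10 J w2, form10 J w3,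
    forall a, form10 J a -> exists c1 c2 c3 : R[i],
      forall x, a x = c1 * w1 x + c2 * w2 x + c3 * w3 x &
    forall c1 c2 c3 : R[i],
      (forall x, c1 * w1 x + c2 * w2 x + c3 * w3 x = 0) ->
      [/\ c1 = 0, c2 = 0 & c3 = 0]].

Definition lie_automorphism (F : 'End(g)) : Prop :=
  bijective F /\ forall x y, F (lie x y) = lie (F x) (F y).

Definition isomorphic_cs J J' : Prop :=
  exists F : 'End(g), lie_automorphism F /\ forall x, F (J x) = J' (F x).

End ComplexStructures.

Section G8.
Variable R : realType.

Definition g8 : Type := 'rV[R]_6.
HB.instance Definition _ := Vector.on g8.

(* The dual basis [e^1, .., e^6], numbered from 1. *)
Definition g8_e (k : nat) (x : g8) : R := x 0 (inord k.-1).

(* [g8_eps k] is the prescribed value of [d e^k], for [1 <= k <= 6]. *)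
Definition g8_eps (k : nat) (x y : g8) : R :=
  let e i j := wedge (g8_e i) (g8_e j) x y in
  nth 0 [:: e 1 6 - e 2 5;
            e 1 5 + e 2 6;
            - e 3 6 + e 4 5;
            - e 3 5 - e 4 6;
            0;
            0] k.-1.

(* Forced by [d e^k = - e^k \o lie]; see [g8_structure_equations]. *)
Definition g8_lie (x y : g8) : g8 := \row_(k < 6) - g8_eps k.+1 x y.

Lemma g8_eE (k : nat) (x y : g8) :
  (0 < k <= 6)%N -> g8_e k (g8_lie x y) = - g8_eps k x y.
Proof. by case: k => // k /= lk; rewrite /g8_e mxE inordK. Qed.

Lemma g8_ext (x y : g8) :
  (forall k, (0 < k <= 6)%N -> g8_e k x = g8_e k y) -> x = y.
Proof.
move=> h; apply/rowP => k; have := h k.+1; rewrite /g8_e /= inord_val.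
by apply; rewrite ltn_ord.
Qed.

Lemma g8_eP (k : nat) (c : R) (x y : g8) :
  g8_e k (c *: x + y) = c * g8_e k x + g8_e k y.
Proof. by rewrite /g8_e !mxE. Qed.

Lemma g8_eD (k : nat) (x y : g8) : g8_e k (x + y) = g8_e k x + g8_e k y.
Proof. by rewrite /g8_e !mxE. Qed.

Lemma g8_e0 (k : nat) : g8_e k (0 : g8) = 0.
Proof. by rewrite /g8_e !mxE. Qed.

Fact g8_lie_linearl (c : R) (x y z : g8) :
  g8_lie (c *: x + y) z = c *: g8_lie x z + g8_lie y z.
Proof.
apply: g8_ext => k hk; rewrite g8_eP !g8_eE //.
by case: k hk => [|[|[|[|[|[|[|k]]]]]]] // _;
  rewrite /g8_eps /wedge /= ?g8_eP; ring.
Qed.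

Fact g8_lie_linearr (c : R) (x y z : g8) :
  g8_lie z (c *: x + y) = c *: g8_lie z x + g8_lie z y.
Proof.
apply: g8_ext => k hk; rewrite g8_eP !g8_eE //.
by case: k hk => [|[|[|[|[|[|[|k]]]]]]] // _;
  rewrite /g8_eps /wedge /= ?g8_eP; ring.
Qed.

Fact g8_lie_alt (x : g8) : g8_lie x x = 0.
Proof.
apply: g8_ext => k hk; rewrite g8_e0 !g8_eE //.
by case: k hk => [|[|[|[|[|[|[|k]]]]]]] // _; rewrite /g8_eps /wedge /=; ring.
Qed.

Fact g8_lie_jacobi (x y z : g8) :
  g8_lie x (g8_lie y z) + g8_lie y (g8_lie z x) + g8_lie z (g8_lie x y) = 0.
Proof.
apply: g8_ext => k hk; rewrite g8_e0 !g8_eD !g8_eE //.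
by case: k hk => [|[|[|[|[|[|[|k]]]]]]] // _;
  rewrite /g8_eps /wedge /= ?g8_eE // /g8_eps /wedge /=; ring.
Qed.

HB.instance Definition _ := Vector_isLieAlgebra.Build R g8
  g8_lie_linearl g8_lie_linearr g8_lie_alt g8_lie_jacobi.

Lemma g8_structure_equations (k : nat) (x y : g8) :
  (0 < k <= 6)%N -> ce_d1 (g8_e k) x y = g8_eps k x y.
Proof. by move=> hk; rewrite /ce_d1 g8_eE // opprK. Qed.

End G8.

Variant g8_label (R : realType) : Type :=
  | LabelJ
  | LabelJ'
  | LabelJA of R[i].
Arguments LabelJ {R}.
Arguments LabelJ' {R}.

Definition valid_label (R : realType) (l : g8_label R) : Prop :=
  match l with
  | LabelJ | LabelJ' => True
  | LabelJA A => complex.Im A != 0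
  end.

Definition reduced_equations (R : realType) (g : lieAlgType R)
    (l : g8_label R) (w1 w2 w3 : g -> R[i]) : Prop :=
  let cj (a : g -> R[i]) := fun x => (a x)^* in
  forall x y : g,
  let w13 := wedge w1 w3 x y in
  let w23 := wedge w2 w3 x y in
  let w1_3 := wedge w1 (cj w3) x y in
  let w2_3 := wedge w2 (cj w3) x y in
  let w3_3 := wedge w3 (cj w3) x y in
  match l with
  | LabelJ =>
      [/\ ce_d1 w1 x y = 2 * 'i%C * w13 + w3_3,
          ce_d1 w2 x y = - (2 * 'i%C) * w23 &
          ce_d1 w3 x y = 0]
  | LabelJ' =>
      [/\ ce_d1 w1 x y = 2 * 'i%C * w13 + w3_3,
          ce_d1 w2 x y = - (2 * 'i%C) * w23 + w3_3 &
          ce_d1 w3 x y = 0]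
  | LabelJA A =>
      [/\ ce_d1 w1 x y = - (A - 'i%C) * w13 - (A + 'i%C) * w1_3,
          ce_d1 w2 x y = (A - 'i%C) * w23 + (A + 'i%C) * w2_3 &
          ce_d1 w3 x y = 0]
  end.

Definition has_reduced_equations (R : realType) (g : lieAlgType R)
    (l : g8_label R) (J : 'End(g)) : Prop :=
  exists w1 w2 w3 : g -> R[i],
    basis10 J w1 w2 w3 /\ reduced_equations l w1 w2 w3.

(* Main.v *)
From HB Require Import structures.
Require Import Defs.
From mathcomp Require Import all_boot all_order all_algebra.
From mathcomp Require Import complex reals boolp ring lra.

(** In the complex coframe [z1 = e^1 + i e^2], [z2 = e^3 + i e^4],
[z3 = e^6 + i e^5] the algebra reads [d z1 = z1 /\ z3], [d z2 = - z2 /\ z3],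
[d z3 = 0]: it is the complex plane acting on the abelian ideal [z3 = 0] with
weights [z3] and [- z3].

Suppose that [psi] is a closed form of type (3,0). Its components are weight
vectors for this action, and closedness kills those of the wrong weight. On
three vectors of the ideal all weights are [+- z3] or their conjugates, hence
nonzero, and [psi] vanishes ([volume_ideal]). For [x], [y] in the ideal the form
[t |-> psi x y t] is therefore a (1,0)-form pulled back from the [z3]-plane. On
[z1 /\ conj z1], [z2 /\ conj z2], [z1 /\ conj z2] and its conjugate the weights
are [+- (z3 + conj z3)] and [+- (z3 - conj z3)], and closedness makes the
corresponding (1,0)-forms proportional to them, that is to real forms; but a
nonzero (1,0)-form is never a complex multiple of a real form
([form10_real_multiple_eq0]). What survives is a combination of [z1 /\ z2] and
its conjugate, both of weight zero. A (3,0)-form in dimension six is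
decomposable, so the Plücker relation leaves exactly one of the two
([volume_ratio]). In other words [J] preserves the ideal and acts on it as
multiplication by [i] or [-i].

Contracting [psi] with vectors of the ideal then gives a (1,0)-coframe in which,
with [z3] (or its conjugate) written [lam w3 + mu conj w3],
<<
  d w1 =   lam w1/\w3 + mu w1/\conj w3 + k1 w3/\conj w3,
  d w2 = - lam w2/\w3 - mu w2/\conj w3 + k2 w3/\conj w3,    d w3 = 0,
>>
where [|lam| <> |mu|] because [z3] and its conjugate are independent
([frame_normal_form]).

It remains to normalise. A change [w1 + e1 w3], [w2 + e2 w3] subtracts multiples
of [mu] from [k1], [k2], so both can be removed unless [mu = 0]; rescaling [w3]
by [c^-1] multiplies [lam] by [c] and [mu] by [conj c]. One real-linear equation
for [c] brings [(lam, mu)] to the shape [(- (A - i), - (A + i))], and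
[|lam| <> |mu|] becomes [Im A <> 0]. When [mu = 0] and [k1], [k2] do not both
vanish, scaling makes them [1] or [0], after an exchange of [w1] and [w2] if
necessary ([normal_form_label]).

Conversely, two such coframes of the same [J] differ by a triangular change of
this kind, up to the exchange of [w1] and [w2]: [w3] spans the closed
(1,0)-forms, and [w1], [w2] are separated by their opposite weights
([normal_form_unique]). Comparing parameters then separates the labels, and
isomorphisms reduce to this case by pulling coframes back. *)

Set Implicit Arguments.
Unset Strict Implicit.
Unset Printing Implicit Defensive.

Import GRing.Theory Num.Theory.
Local Open Scope ring_scope.
Local Open Scope complex_scope.

Local Notation "''i'" := ('i%C) : ring_scope.
Local Notation "x ^*" := (x^*%C) : ring_scope.

(** * Complex numbers, forms of type (1,0) and normal forms *)

Section ComplexNumbers.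
Variable R : realType.
Implicit Types a b c d k : R[i].

Lemma conjc_i : ('i : R[i])^* = - 'i.
Proof. by apply/eqP; rewrite eq_complex /= oppr0 !eqxx. Qed.

Lemma conjcM a b : (a * b)^* = a^* * b^*.
Proof. exact: rmorphM. Qed.

Lemma conjcD a b : (a + b)^* = a^* + b^*.
Proof. exact: rmorphD. Qed.

Lemma conjcB a b : (a - b)^* = a^* - b^*.
Proof. exact: rmorphB. Qed.

Lemma two_neq0 : (2 : R[i]) != 0.
Proof. by rewrite pnatr_eq0. Qed.

Lemma i_neq0 : ('i : R[i]) != 0.
Proof. by rewrite eq_complex /= oner_eq0 andbF. Qed.

(** With an explicit multiplier, [ring] closes consequences of an equation. *)
Lemma eq_of_multiple a b (x y k : R[i]) : a = b -> x - y = k * (a - b) -> x = y.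
Proof. by move=> ->; rewrite subrr mulr0 => /eqP; rewrite subr_eq0 => /eqP. Qed.

Lemma eq_of_multiples a b c d (x y k m : R[i]) : a = b -> c = d ->
  x - y = k * (a - b) + m * (c - d) -> x = y.
Proof.
by move=> -> ->; rewrite !subrr !mulr0 addr0 => /eqP; rewrite subr_eq0 => /eqP.
Qed.

Lemma conjcE a : a^* = (complex.Re a)%:C - 'i * (complex.Im a)%:C.
Proof.
by case: a => p q; apply/eqP; rewrite eq_complex /=; apply/andP; split;
  apply/eqP; ring.
Qed.

End ComplexNumbers.

Section Forms.
Variables (R : realType) (g : lieAlgType R) (J : 'End(g)).
Implicit Types (a w : g -> R[i]) (psi : g -> g -> g -> R[i]) (x y z : g).

Lemma cform1D a x y : cform1 a -> a (x + y) = a x + a y.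
Proof. by move=> /(_ 1 x y); rewrite scale1r mul1r. Qed.

Lemma cform10 a : cform1 a -> a 0 = 0.
Proof.
by move=> ha; have /eqP := cform1D 0 0 ha; rewrite addr0 -subr_eq0 opprD addrA
  subrr sub0r oppr_eq0 => /eqP.
Qed.

Lemma cform1Z a c x : cform1 a -> a (c *: x) = c%:C * a x.
Proof. by move=> ha; rewrite -[c *: x]addr0 ha cform10 // addr0. Qed.

Lemma cform1N a x : cform1 a -> a (- x) = - a x.
Proof. by move=> ha; rewrite -scaleN1r cform1Z // rmorphN1 mulN1r. Qed.

Lemma form10_cform1 a : form10 J a -> cform1 a.
Proof. by case. Qed.

Lemma form10J a x : form10 J a -> a (J x) = 'i * a x.
Proof. by case. Qed.

Lemma form10J_conj a x : form10 J a -> (a (J x))^* = - 'i * (a x)^*.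
Proof. by move=> ha; rewrite (form10J _ ha) conjcM conjc_i. Qed.

Lemma form10_comb k1 k2 a1 a2 : form10 J a1 -> form10 J a2 ->
  form10 J (fun x => k1 * a1 x + k2 * a2 x).
Proof.
move=> [h1 j1] [h2 j2]; split=> [c x y|x]; rewrite ?h1 ?h2 ?j1 ?j2; ring.
Qed.

Lemma form10_scale k a : form10 J a -> form10 J (fun x => k * a x).
Proof. by move=> [h j]; split=> [c x y|x]; rewrite ?h ?j; ring. Qed.

(** [a (J x) = i a x] would make the real number [r (J x)] equal to
[i * r x]. *)
Lemma form10_real_multiple_eq0 a (r : g -> R) (k : R[i]) :
  form10 J a -> (forall x, a x = (r x)%:C * k) -> forall x, a x = 0.
Proof.
move=> ha hr x; have [k0|k0] := eqVneq k 0; first by rewrite hr k0 mulr0.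
have := form10J x ha; rewrite !hr mulrA => /(mulIf k0) h.
suff -> : r x = 0 by rewrite rmorph0 mul0r.
by move: h => /(congr1 (@complex.Im R)) /=; rewrite mul0r mul1r add0r => <-.
Qed.

Lemma form30_swap12 psi x y z : cform3 psi -> psi x y z = - psi y x z.
Proof.
case=> l1 l2 l3 a12 a23; have := a12 (x + y) z.
rewrite (cform1D x y (l1 (x + y) z)) (cform1D x y (l2 x z)).
rewrite (cform1D x y (l2 y z)) !a12 add0r addr0 => /eqP.
by rewrite addr_eq0 => /eqP.
Qed.

Lemma form30_swap23 psi x y z : cform3 psi -> psi x y z = - psi x z y.
Proof.
case=> l1 l2 l3 a12 a23; have := a23 x (y + z).
rewrite (cform1D y z (l2 x (y + z))) (cform1D y z (l3 x y)).
rewrite (cform1D y z (l3 x z)) !a23 add0r addr0 => /eqP.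
by rewrite addr_eq0 => /eqP.
Qed.

Lemma form30_1 psi y z : form30 J psi -> form10 J (fun x => psi x y z).
Proof. by case=> [[l1 _ _ _ _] h]; split. Qed.

Lemma form30_2 psi x z : form30 J psi -> form10 J (fun y => psi x y z).
Proof.
move=> h; have h3 := h.1; split; first by case: h3.
by move=> y; rewrite form30_swap12 // h.2 form30_swap12 // mulrN opprK.
Qed.

Lemma form30_3 psi x y : form30 J psi -> form10 J (fun z => psi x y z).
Proof.
move=> h; have h3 := h.1; split; first by case: h3.
move=> z; rewrite form30_swap23 // (form10J _ (form30_2 _ _ h)).
by rewrite form30_swap23 // mulrN opprK.
Qed.

(** The common shape of all the reduced equations: the form
[lam w3 + mu conj w3] acts on [w1] and, with the opposite sign, on [w2], up to
the defects [k1] and [k2]. *)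
Definition normal_form (lam mu k1 k2 : R[i]) w1 w2 w3 : Prop :=
  forall x y,
  [/\ ce_d1 w1 x y = lam * wedge w1 w3 x y
        + mu * wedge w1 (fun t => (w3 t)^*) x y
        + k1 * wedge w3 (fun t => (w3 t)^*) x y,
      ce_d1 w2 x y = - lam * wedge w2 w3 x y
        - mu * wedge w2 (fun t => (w3 t)^*) x y
        + k2 * wedge w3 (fun t => (w3 t)^*) x y &
      ce_d1 w3 x y = 0].

Lemma normal_form_swap lam mu k1 k2 w1 w2 w3 :
  normal_form lam mu k1 k2 w1 w2 w3 ->
  normal_form (- lam) (- mu) k2 k1 w2 w1 w3.
Proof.
by move=> h x y; have [-> -> ->] := h x y; split=> //; ring.
Qed.

Lemma basis10_swap w1 w2 w3 : basis10 J w1 w2 w3 -> basis10 J w2 w1 w3.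
Proof.
case=> f1 f2 f3 sp ind; split=> // [a /sp [c1 [c2 [c3 h]]]|c1 c2 c3 h].
  by exists c2, c1, c3 => x; rewrite h; ring.
have [|-> -> ->] // := ind c2 c1 c3.
by move=> x; rewrite -[RHS](h x); ring.
Qed.

Lemma basis10_change w1 w2 w3 s1 s2 s3 e1 e2 :
  s1 != 0 -> s2 != 0 -> s3 != 0 -> basis10 J w1 w2 w3 ->
  basis10 J (fun x => s1 * (w1 x + e1 * w3 x)) (fun x => s2 * (w2 x + e2 * w3 x))
            (fun x => s3 * w3 x).
Proof.
move=> n1 n2 n3 [f1 f2 f3 sp ind].
have f13 s e w : form10 J w -> form10 J (fun x => s * (w x + e * w3 x)).
  move=> [lw jw]; case: f3 => l3 j3.
  by split=> [c x y|x]; rewrite ?lw ?l3 ?jw ?j3; ring.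
split=> [||| a /sp [c1 [c2 [c3 h]]]|c1 c2 c3 h].
- exact: f13.
- exact: f13.
- exact: form10_scale.
- exists (c1 / s1), (c2 / s2), ((c3 - c1 * e1 - c2 * e2) / s3) => x.
  by rewrite h; field; apply/and3P.
have [x|] := ind (c1 * s1) (c2 * s2) (c1 * s1 * e1 + c2 * s2 * e2 + c3 * s3).
  by rewrite -[RHS](h x); ring.
move=> /eqP; rewrite mulf_eq0 (negbTE n1) orbF => /eqP ->.
move=> /eqP; rewrite mulf_eq0 (negbTE n2) orbF => /eqP ->.
rewrite !mul0r !add0r => /eqP; rewrite mulf_eq0 (negbTE n3) orbF => /eqP ->.
by [].
Qed.

(** The factor of [w3] is written as an inverse so that [lam] and [mu] are
multiplied by [c] and its conjugate. *)
Lemma normal_form_change lam mu k1 k2 w1 w2 w3 s1 s2 c e1 e2 : c != 0 ->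
  normal_form lam mu k1 k2 w1 w2 w3 ->
  normal_form (lam * c) (mu * c^*)
    (s1 * (k1 - e1 * mu) * (c * c^*)) (s2 * (k2 + e2 * mu) * (c * c^*))
    (fun x => s1 * (w1 x + e1 * w3 x)) (fun x => s2 * (w2 x + e2 * w3 x))
    (fun x => c^-1 * w3 x).
Proof.
move=> c0 h x y; have [] := h x y; rewrite /ce_d1 /wedge => h1 h2 h3.
have cc0 : c^* != 0 by rewrite fmorph_eq0.
have e3 : w3 (lie x y) = 0 by apply/eqP; rewrite -oppr_eq0 h3.
rewrite !rmorphM /= !fmorphV /= e3 !mulr0 !addr0.
split; last by rewrite oppr0.
- by rewrite -mulrN h1; field; apply/andP.
- by rewrite -mulrN h2; field; apply/andP.
Qed.

(** Replacing [x] by [J x] separates the (1,0)-part from the (0,1)-part. *)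
Lemma conj_independent w1 w2 w3 (a b : R[i]) : basis10 J w1 w2 w3 ->
  (forall x, a * w3 x + b * (w3 x)^* = 0) -> a = 0 /\ b = 0.
Proof.
move=> [f1 f2 f3 sp ind] h.
have a0 : a = 0.
  have [|//] := ind 0 0 a _ => x; rewrite !mul0r !add0r.
  have := h (J x); rewrite (form10J _ f3) conjcM conjc_i => hJ.
  apply: (mulfI (two_neq0 R)); rewrite mulr0 mulrC.
  have -> : a * w3 x * 2 = (a * w3 x + b * (w3 x)^*)
      - 'i * (a * ('i * w3 x) + b * (- 'i * (w3 x)^*)) by ring: (sqr_i R).
  by rewrite h hJ mulr0 subrr.
split=> //; apply/eqP/negP => /negP b0.
have [|_ _ /eqP] := ind 0 0 1; last by rewrite oner_eq0.
move=> x; rewrite !mul0r !add0r mul1r.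
have := h x; rewrite a0 mul0r add0r => /eqP.
by rewrite mulf_eq0 (negbTE b0) fmorph_eq0 => /eqP.
Qed.

(** Separating the types in the second argument reduces the claim to the
independence of the (1,0)-forms, applied once in each argument. *)
Lemma wedge_independent w1 w2 w3 (a b c d k : R[i]) : basis10 J w1 w2 w3 ->
  (forall x y, a * wedge w1 w3 x y + b * wedge w1 (fun t => (w3 t)^*) x y
    + c * wedge w2 w3 x y + d * wedge w2 (fun t => (w3 t)^*) x y
    + k * wedge w3 (fun t => (w3 t)^*) x y = 0) ->
  [/\ a = 0, b = 0, c = 0, d = 0 & k = 0].
Proof.
move=> bw h; have [f1 f2 f3 sp ind] := bw.
(* The (1,0)-part of the form in its second argument. *)
have P x y : (- a * w3 x - b * (w3 x)^*) * w1 y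
    + (- c * w3 x - d * (w3 x)^*) * w2 y
    + (a * w1 x + c * w2 x - k * (w3 x)^*) * w3 y = 0.
  have := h x (J y); have := h x y; rewrite /wedge.
  rewrite (form10J _ f1) (form10J _ f2) (form10J _ f3) conjcM conjc_i.
  move=> h1 h2; apply: (mulfI (two_neq0 R)); rewrite mulr0.
  set u := (X in X = 0) in h1; set v := (X in X = 0) in h2.
  transitivity (u - 'i * v); last by rewrite h1 h2 mulr0 subrr.
  by rewrite /u /v; ring: (sqr_i R).
have Q x := ind _ _ _ (P x).
have [a0 b0] : - a = 0 /\ - b = 0.
  apply: (conj_independent bw) => x; have [q _ _] := Q x.
  by rewrite -[RHS]q; ring.
have [c0 d0] : - c = 0 /\ - d = 0.
  apply: (conj_independent bw) => x; have [_ q _] := Q x.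
  by rewrite -[RHS]q; ring.
move: a0 b0 c0 d0 => /eqP; rewrite oppr_eq0 => /eqP a0.
move=> /eqP; rewrite oppr_eq0 => /eqP b0.
move=> /eqP; rewrite oppr_eq0 => /eqP c0.
move=> /eqP; rewrite oppr_eq0 => /eqP d0.
have [_ k0] : 0 = 0 :> R[i] /\ - k = 0.
  apply: (conj_independent bw) => x; have [_ _ q] := Q x.
  by rewrite -[RHS]q a0 c0; ring.
by split=> //; apply/eqP; rewrite -oppr_eq0 k0.
Qed.

End Forms.

(** * Parameters of normal forms of one complex structure *)

Section Labels.
Variable R : realType.
Implicit Types l : g8_label R.

Definition label_lam l : R[i] := if l is LabelJA A then - (A - 'i) else 2 * 'i.
Definition label_mu l : R[i] := if l is LabelJA A then - (A + 'i) else 0.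
Definition label_k1 l : R[i] := if l is LabelJA _ then 0 else 1.
Definition label_k2 l : R[i] := if l is LabelJ' then 1 else 0.

Lemma reduced_equationsE (g : lieAlgType R) l (w1 w2 w3 : g -> R[i]) :
  reduced_equations l w1 w2 w3 <->
  normal_form (label_lam l) (label_mu l) (label_k1 l) (label_k2 l) w1 w2 w3.
Proof.
split.
- by move=> h x y; have := h x y; case: l {h} => [||A] /= [-> -> ->];
    split=> //; ring.
- move=> h; rewrite /reduced_equations => x y; have := h x y.
  by case: l {h} => [||A] /= [-> -> ->]; split=> //; ring.
Qed.

(** [|A - i|^2 - |A + i|^2 = - 4 Im A]. *)
Lemma valid_label_norm l : valid_label l ->
  label_lam l * (label_lam l)^* != label_mu l * (label_mu l)^*.
Proof.
have h2 : (2 * 'i : R[i]) * (2 * 'i)^* != 0 * 0^*.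
  by rewrite mul0r mulf_neq0 ?fmorph_eq0 // mulf_neq0 ?two_neq0 ?i_neq0.
case: l => [||[a b]] //= A0; apply: contra A0 => /eqP h.
have {h} : (- ((a +i* b) - 'i)) * (- ((a +i* b) - 'i))^*
         - (- ((a +i* b) + 'i)) * (- ((a +i* b) + 'i))^* = 0.
  by apply/eqP; rewrite subr_eq0 h.
move=> /(congr1 (@complex.Re R)) /= h; apply/eqP; lra.
Qed.

(** How parameters transform when [w3] is replaced by [c w3], [w1] by
[m1 w1 + e1 w3] and [w2] by [m2 w2 + e2 w3]. *)
Definition related_params (lam mu k1 k2 lam' mu' k1' k2' : R[i]) : Prop :=
  exists c m1 m2 e1 e2, [/\ c != 0, m1 != 0, m2 != 0, lam = lam' * c &
    [/\ mu = mu' * c^*, m1 * k1 = e1 * mu' * c^* + k1' * c * c^* &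
        m2 * k2 = - (e2 * mu' * c^*) + k2' * c * c^*]].

(** Whether [mu] vanishes and how many of [k1], [k2] do tells the three families
apart. Inside the last one, [A - i = (A' - i) c] and [A + i = (A' + i) conj c]
subtract to [2 i = A' (conj c - c) + i (c + conj c)], and [Im A' <> 0] forces
[c = 1]; the exchange of [w1] and [w2] changes the sign of [c]. *)
Lemma label_unique l1 l2 : valid_label l1 -> valid_label l2 ->
  related_params (label_lam l1) (label_mu l1) (label_k1 l1) (label_k2 l1)
    (label_lam l2) (label_mu l2) (label_k1 l2) (label_k2 l2) \/
  related_params (- label_lam l1) (- label_mu l1) (label_k2 l1) (label_k1 l1)
    (label_lam l2) (label_mu l2) (label_k1 l2) (label_k2 l2) ->
  l1 = l2.
Proof.
have n1 : (1 : R[i]) != 0 := oner_neq0 _.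
have cc (c k : R[i]) : c != 0 -> k * c * c^* = 0 -> k = 0.
  move=> c0 /eqP; rewrite !mulf_eq0 fmorph_eq0 (negbTE c0) !orbF.
  by move=> /eqP.
have AA (a b p q u v : R) : q != 0 ->
    a +i* b - 'i = (p +i* q - 'i) * (u +i* v) ->
    a +i* b + 'i = (p +i* q + 'i) * (u +i* v)^* -> a +i* b = p +i* q.
  move=> q0 /eqP; rewrite eq_complex /= => /andP[/eqP h1 /eqP h2] /eqP.
  rewrite eq_complex /= => /andP[/eqP h3 /eqP h4].
  have v0 : v = 0.
    by apply: (mulfI q0); apply: (mulfI (_ : 2 != 0 :> R)); [rewrite pnatr_eq0|lra].
  have u1 : u = 1 by rewrite v0 in h1 h2 h3 h4; lra.
  by rewrite v0 u1 in h1 h2; congr Complex; lra.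
have absurd1 (c m e : R[i]) : c != 0 -> m * 0 = e * 0 * c^* + 1 * c * c^* ->
    False.
  move=> c0 h; suff : (1 : R[i]) = 0 by move/eqP; rewrite (negbTE n1).
  by apply: (cc _ _ c0); rewrite -[RHS](mulr0 m) h; ring.
have absurd2 (c m e : R[i]) : c != 0 ->
    m * 0 = - (e * 0 * c^*) + 1 * c * c^* -> False.
  by move=> c0 h; apply: (@absurd1 c m (- e) c0); rewrite h; ring.
have absurd3 (c m e mu : R[i]) : m != 0 -> 0 = mu * c^* ->
    m * 1 = e * mu * c^* + 0 * c * c^* -> False.
  move=> /negP m0 h0 h; apply: m0; apply/eqP.
  by rewrite -[LHS]mulr1 h -mulrA -h0; ring.
have absurd4 (c m e mu : R[i]) : m != 0 -> 0 = mu * c^* ->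
    m * 1 = - (e * mu * c^*) + 0 * c * c^* -> False.
  by move=> m0 h0 h; apply: (@absurd3 c m (- e) mu m0 h0); rewrite h; ring.
case: l1 l2 => [||A] [||A'] //= v1 v2.
all: case=> -[c [m1 [m2 [e1 [e2 [c0 n1' n2' hl [hm h1 h2]]]]]]].
all: rewrite ?oppr0 in hm.
all: try by case: (absurd1 c m1 e1 c0 h1).
all: try by case: (absurd2 c m2 e2 c0 h2).
all: try by case: (absurd3 c m1 e1 _ n1' hm h1).
all: try by case: (absurd4 c m2 e2 _ n2' hm h2).
all: try by case: (absurd4 c m2 e2 0 n2' (esym (mul0r _)) h2).
- case: A A' c c0 v1 v2 hl hm {h1 h2} => [a b] [p q] [u v] _ _ q0 hl hm.
  congr LabelJA; apply: (AA a b p q u v q0).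
    by apply: oppr_inj; rewrite hl mulNr.
  by apply: oppr_inj; rewrite hm mulNr.
- case: A A' c c0 v1 v2 hl hm {h1 h2} => [a b] [p q] [u v] _ _ q0 hl hm.
  congr LabelJA; apply: (AA a b p q (- u) (- v) q0).
    have -> : (- u) +i* (- v) = - (u +i* v) by [].
    by move: hl; rewrite opprK mulrN mulNr.
  have -> : (- u) +i* (- v) = - (u +i* v) by [].
  by move: hm; rewrite opprK rmorphN mulrN mulNr.
Qed.

End Labels.

Section Uniqueness.
Variables (R : realType) (g : lieAlgType R) (J : 'End(g)).

(** Express [v1], [v2], [v3] in the basis [w1], [w2], [w3] and compare the
coefficients of their differentials. Since [(lam, mu) <> 0], the only closed
(1,0)-forms are the multiples of [w3]. If [v1] has a component along [w1], its
weight is that of [w1], which excludes a component along [w2] and determines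
[v2] likewise; otherwise the roles of [w1] and [w2] are exchanged. *)
Lemma normal_form_unique lam mu k1 k2 lam' mu' k1' k2'
    (w1 w2 w3 v1 v2 v3 : g -> R[i]) :
  basis10 J w1 w2 w3 -> basis10 J v1 v2 v3 ->
  normal_form lam mu k1 k2 w1 w2 w3 ->
  normal_form lam' mu' k1' k2' v1 v2 v3 ->
  lam * lam^* != mu * mu^* ->
  related_params lam mu k1 k2 lam' mu' k1' k2' \/
  related_params (- lam) (- mu) k2 k1 lam' mu' k1' k2'.
Proof.
move=> bw bv hw hv lm; have [f1 f2 f3 sp ind] := bw.
have [fv1 fv2 fv3 _ indv] := bv.
have [a11 [a12 [a13 e1]]] := sp _ fv1.
have [a21 [a22 [a23 e2]]] := sp _ fv2.
have [a31 [a32 [c e3]]] := sp _ fv3.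
have lm0 : (lam != 0) || (mu != 0).
  by apply: contraR lm; rewrite negb_or !negbK => /andP[/eqP -> /eqP ->].
have killed (k : R[i]) : k * lam = 0 -> k * mu = 0 -> k = 0.
  move=> /eqP + /eqP; rewrite !mulf_eq0.
  by case/orP: lm0 => /negbTE ->; rewrite orbF => ? ?; apply/eqP.
have [a31_0 a32_0] : a31 = 0 /\ a32 = 0.
  have [|h1 h2 h3 h4 _] := @wedge_independent _ _ _ _ _ _ (a31 * lam)
    (a31 * mu) (- a32 * lam) (- a32 * mu) (a31 * k1 + a32 * k2) bw.
    move=> x y; have [_ _ ] := hv x y; rewrite /ce_d1 e3 => <-.
    have [] := hw x y; rewrite /ce_d1 => /eqP; rewrite eqr_oppLR => /eqP ->.
    move=> /eqP; rewrite eqr_oppLR => /eqP ->.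
    move=> /eqP; rewrite eqr_oppLR => /eqP ->; ring.
  split; first exact: killed.
  by apply/eqP; rewrite -oppr_eq0; apply/eqP/killed.
have {}e3 x : v3 x = c * w3 x by rewrite e3 a31_0 a32_0; ring.
have c0 : c != 0.
  apply/eqP => c0; have [|_ _ /eqP] := indv 0 0 1; last by rewrite oner_eq0.
  by move=> x; rewrite e3 c0; ring.
(* The case of [v1] for [s = 1] and of [v2] for [s = -1]. *)
have comp s (v : g -> R[i]) (b1 b2 b3 k : R[i]) :
    (forall x, v x = b1 * w1 x + b2 * w2 x + b3 * w3 x) ->
    (forall x y, ce_d1 v x y = s * lam' * wedge v v3 x y
       + s * mu' * wedge v (fun t => (v3 t)^*) x y
       + k * wedge v3 (fun t => (v3 t)^*) x y) ->
    [/\ b1 * (lam - s * lam' * c) = 0, b1 * (mu - s * mu' * c^*) = 0,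
        b2 * (- lam - s * lam' * c) = 0, b2 * (- mu - s * mu' * c^*) = 0 &
        b1 * k1 + b2 * k2 - s * b3 * mu' * c^* - k * c * c^* = 0].
  move=> ev hd; apply: (wedge_independent bw) => x y.
  have := hd x y; rewrite /wedge /ce_d1 !ev !e3 !conjcM => hd1.
  have [] := hw x y; rewrite /ce_d1 => /eqP; rewrite eqr_oppLR => /eqP h1.
  move=> /eqP; rewrite eqr_oppLR => /eqP h2.
  move=> /eqP; rewrite eqr_oppLR => /eqP h3.
  move: hd1 => /eqP; rewrite h1 h2 h3 -subr_eq0 => /eqP hd1.
  by rewrite -[RHS]hd1 /wedge; ring.
have [p1 p2 p3 p4 p5] := comp 1 v1 a11 a12 a13 k1' e1
  (fun x y => ltac:(by have [-> _ _] := hv x y; ring)).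
have [q1 q2 q3 q4 q5] := comp (-1) v2 a21 a22 a23 k2' e2
  (fun x y => ltac:(by have [_ -> _] := hv x y; ring)).
have lmE (b : R[i]) : b != 0 -> b * 2 != 0 by move=> ?; rewrite mulf_neq0 ?two_neq0.
have half_killed (k : R[i]) : k * 2 * lam = 0 -> k * 2 * mu = 0 -> k = 0.
  by move=> h1 h2; apply/eqP; apply/negPn/negP => /lmE/eqP; apply; apply: killed.
have row1 : (a11 != 0) || (a12 != 0).
  apply/negPn/negP; rewrite negb_or !negbK => /andP[/eqP z1 /eqP z2].
  have [|/eqP] := indv 1 0 (- (a13 / c)); last by rewrite oner_eq0.
  by move=> x; rewrite e1 e3 z1 z2; field.
have row2 : (a21 != 0) || (a22 != 0).
  apply/negPn/negP; rewrite negb_or !negbK => /andP[/eqP z1 /eqP z2].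
  have [|_ /eqP] := indv 0 1 (- (a23 / c)); last by rewrite oner_eq0.
  by move=> x; rewrite e2 e3 z1 z2; field.
have cancel (b x y : R[i]) : b != 0 -> b * (x - y) = 0 -> x = y.
  move=> b0 /eqP; rewrite mulf_eq0 (negbTE b0) subr_eq0 => /eqP //.
have [z11|n11] := eqVneq a11 0.
  have n12 : a12 != 0 by rewrite z11 eqxx in row1.
  right; have lE := cancel _ _ _ n12 p3; have mE := cancel _ _ _ n12 p4.
  have z22 : a22 = 0.
    apply: half_killed.
      by apply: (eq_of_multiples (k := -1) (m := - a22) q3 lE); ring.
    by apply: (eq_of_multiples (k := -1) (m := - a22) q4 mE); ring.
  have n21 : a21 != 0 by rewrite z22 eqxx orbF in row2.
  exists c, a12, a21, a13, a23; split=> //; first by rewrite lE mul1r.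
  split; first by rewrite mE mul1r.
    by apply: (eq_of_multiple (k := 1) p5); rewrite z11; ring.
  by apply: (eq_of_multiple (k := 1) q5); rewrite z22; ring.
left; have lE := cancel _ _ _ n11 p1; have mE := cancel _ _ _ n11 p2.
have z12 : a12 = 0.
  apply: half_killed.
    by apply: (eq_of_multiples (k := -1) (m := a12) p3 lE); ring.
  by apply: (eq_of_multiples (k := -1) (m := a12) p4 mE); ring.
have z21 : a21 = 0.
  apply: half_killed.
    by apply: (eq_of_multiples (k := 1) (m := a21) q1 lE); ring.
  by apply: (eq_of_multiples (k := 1) (m := a21) q2 mE); ring.
have n22 : a22 != 0 by rewrite z21 eqxx in row2.
exists c, a11, a22, a13, a23; split=> //; first by rewrite lE mul1r.
split; first by rewrite mE mul1r.
  by apply: (eq_of_multiple (k := 1) p5); rewrite z12; ring.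
by apply: (eq_of_multiple (k := 1) q5); rewrite z21; ring.
Qed.

End Uniqueness.

(** * Normalisation of the parameters *)

Section Normalisation.
Variables (R : realType) (g : lieAlgType R) (J : 'End(g)).
Implicit Types (w : g -> R[i]) (lam mu k c s e : R[i]).

Lemma reduced_equations_change l lam mu k1 k2 w1 w2 w3 c s1 s2 e1 e2 :
  basis10 J w1 w2 w3 -> normal_form lam mu k1 k2 w1 w2 w3 ->
  c != 0 -> s1 != 0 -> s2 != 0 ->
  [/\ label_lam l = lam * c, label_mu l = mu * c^*,
      label_k1 l = s1 * (k1 - e1 * mu) * (c * c^*) &
      label_k2 l = s2 * (k2 + e2 * mu) * (c * c^*)] ->
  has_reduced_equations l J.
Proof.
move=> bw hw c0 s10 s20 [h1 h2 h3 h4].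
have c0' : c^-1 != 0 by rewrite invr_eq0.
have := basis10_change e1 e2 s10 s20 c0' bw.
have := normal_form_change s1 s2 e1 e2 c0 hw; rewrite -h1 -h2 -h3 -h4.
move=> /reduced_equationsE hr hb; by do 3!eexists; split; [exact: hb | exact: hr].
Qed.

(** The hypotheses on [k1] and [k2] say that they can be removed by adding
multiples of [w3] to [w1] and [w2]. *)
Lemma diagonal_label lam mu k1 k2 w1 w2 w3 e1 e2 :
  basis10 J w1 w2 w3 -> normal_form lam mu k1 k2 w1 w2 w3 ->
  lam * lam^* != mu * mu^* -> k1 = e1 * mu -> k2 = - (e2 * mu) ->
  exists l, valid_label l /\ has_reduced_equations l J.
Proof.
move=> bw hw lm h1 h2.
have nu0 : lam * lam^* - mu * mu^* != 0 by rewrite subr_eq0.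
have n0 : lam^* - mu != 0.
  apply: contra lm; rewrite subr_eq0 => /eqP h.
  by rewrite -h conjcK mulrC.
have nuc : (lam * lam^* - mu * mu^*)^* = lam * lam^* - mu * mu^*.
  by rewrite rmorphB /= !conjcM !conjcK; ring.
(* The solution of [mu * c^* - lam * c = - 2i]; eliminating [c^*] between this
   equation and its conjugate gives the formula. *)
pose c := 2 * 'i * (lam^* - mu) / (lam * lam^* - mu * mu^*).
have c0 : c != 0 by rewrite !mulf_neq0 ?two_neq0 ?i_neq0 ?invr_eq0.
have cE : mu * c^* - lam * c = - (2 * 'i).
  have -> : c^* = - (2 * 'i * (lam - mu^*) / (lam * lam^* - mu * mu^*)).
    rewrite /c !conjcM conjc_i conjc_nat rmorphB /= conjcK.
    by rewrite fmorphV /= nuc; ring.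
  by rewrite /c; field.
clearbody c; exists (LabelJA ('i - lam * c)); split.
  rewrite /=; apply: contra lm => /eqP A0.
  have lmE : mu * c^* = lam * c - 2 * 'i by apply: (eq_of_multiple (k := 1) cE); ring.
  have e : lam * c * (lam * c)^* = mu * c^* * (mu * c^*)^*.
    rewrite lmE; case: (lam * c) A0 => p q /= A0.
    by apply/eqP; rewrite eq_complex /=; apply/andP; split; apply/eqP; nra.
  rewrite !conjcM conjcK in e.
  have cc0 : c * c^* != 0 by rewrite mulf_neq0 ?fmorph_eq0.
  by apply/eqP/(mulfI cc0); apply: (eq_of_multiple (k := 1) e); ring.
apply: (@reduced_equations_change _ _ _ _ _ _ _ _ c 1 1 e1 e2 bw hw) => //;
  rewrite ?oner_neq0 //=.
split; first by ring.
- by apply: (eq_of_multiple (k := -1) cE); ring.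
- by rewrite h1; ring.
- by rewrite h2; ring.
Qed.

(** When the weight [lam w3] is of type (1,0), adding multiples of [w3] does not
change [k1] and [k2], but [w1], [w2], [w3] can be rescaled independently. *)
Lemma holomorphic_weight_label lam mu k1 k2 w1 w2 w3 : mu = 0 -> lam != 0 -> k1 != 0 ->
  basis10 J w1 w2 w3 -> normal_form lam mu k1 k2 w1 w2 w3 ->
  exists l, valid_label l /\ has_reduced_equations l J.
Proof.
move=> mu0 lam0 k10 bw hw; pose c := 2 * 'i / lam.
have c0 : c != 0 by rewrite !mulf_neq0 ?two_neq0 ?i_neq0 ?invr_eq0.
have cc0 : c * c^* != 0 by rewrite mulf_neq0 ?fmorph_eq0.
have [cj0 cl] : c^* != 0 /\ lam * c = 2 * 'i.
  by split; [rewrite fmorph_eq0 | rewrite /c mulrC divfK].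
clearbody c.
have [k20|k20] := eqVneq k2 0.
  exists LabelJ; split=> //.
  apply: (@reduced_equations_change _ _ _ _ _ _ _ _ c (k1 * (c * c^*))^-1 1 0 0
    bw hw); rewrite ?invr_eq0 ?oner_neq0 ?mulf_neq0 //=.
  by split; rewrite ?cl ?mu0 ?k20 //; [ring | field; rewrite k10 c0 cj0 | ring].
exists LabelJ'; split=> //.
apply: (@reduced_equations_change _ _ _ _ _ _ _ _ c (k1 * (c * c^*))^-1
  (k2 * (c * c^*))^-1 0 0 bw hw); rewrite ?invr_eq0 ?mulf_neq0 //=.
by split; rewrite ?cl ?mu0 //;
  [ring | field; rewrite k10 c0 cj0 | field; rewrite k20 c0 cj0].
Qed.

Lemma normal_form_label lam mu k1 k2 w1 w2 w3 :
  basis10 J w1 w2 w3 -> normal_form lam mu k1 k2 w1 w2 w3 ->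
  lam * lam^* != mu * mu^* ->
  exists l, valid_label l /\ has_reduced_equations l J.
Proof.
move=> bw hw lm; have [mu0|mu0] := eqVneq mu 0; last first.
  by apply: (@diagonal_label _ _ _ _ _ _ _ (k1 / mu) (- (k2 / mu)) bw hw lm);
    field.
have lam0 : lam != 0 by apply: contra lm => /eqP ->; rewrite mu0 !mul0r.
have [k10|k10] := eqVneq k1 0; last exact: holomorphic_weight_label bw hw.
have [k20|k20] := eqVneq k2 0.
  by apply: (@diagonal_label _ _ _ _ _ _ _ 0 0 bw hw lm);
    rewrite mul0r ?oppr0.
apply: (holomorphic_weight_label _ _ k20 (basis10_swap bw) (normal_form_swap hw)).
  by rewrite mu0 oppr0.
by rewrite oppr_eq0.
Qed.

End Normalisation.

(** * Complex coordinates on the Lie algebra and dual bases *)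

Section Coordinates.
Variable R : realType.
Implicit Types (x y v : g8 R) (p q t : R[i]).

(** The imaginary part of [z3] is [e^5] and its real part [e^6]: with this order
[z3] is the weight of [z1]. *)
Definition z3 x : R[i] := g8_e 6 x +i* g8_e 5 x.
Definition z1 x : R[i] := g8_e 1 x +i* g8_e 2 x.
Definition z2 x : R[i] := g8_e 3 x +i* g8_e 4 x.

Definition vec p q t : g8 R :=
  \row_(k < 6) nth 0 [:: complex.Re p; complex.Im p; complex.Re q;
    complex.Im q; complex.Im t; complex.Re t] k.

Lemma z1_vec p q t : z1 (vec p q t) = p.
Proof. by case: p => a b; rewrite /z1 /g8_e !mxE !inordK. Qed.

Lemma z2_vec p q t : z2 (vec p q t) = q.
Proof. by case: q => a b; rewrite /z2 /g8_e !mxE !inordK. Qed.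

Lemma z3_vec p q t : z3 (vec p q t) = t.
Proof. by case: t => a b; rewrite /z3 /g8_e !mxE !inordK. Qed.

Definition z_vec := (z1_vec, z2_vec, z3_vec).

Lemma z_inj x y : z1 x = z1 y -> z2 x = z2 y -> z3 x = z3 y -> x = y.
Proof.
move=> [h1 h2] [h3 h4] [h6 h5]; apply: g8_ext.
by do 7?[case=> //].
Qed.

Lemma cform1_z1 : cform1 z1.
Proof.
by move=> c x y; rewrite /z1 !g8_eP; apply/eqP; rewrite eq_complex /=;
  apply/andP; split; apply/eqP; ring.
Qed.

Lemma cform1_z2 : cform1 z2.
Proof.
by move=> c x y; rewrite /z2 !g8_eP; apply/eqP; rewrite eq_complex /=;
  apply/andP; split; apply/eqP; ring.
Qed.

Lemma cform1_z3 : cform1 z3.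
Proof.
by move=> c x y; rewrite /z3 !g8_eP; apply/eqP; rewrite eq_complex /=;
  apply/andP; split; apply/eqP; ring.
Qed.

Lemma z1_lie x y : z1 (lie x y) = z3 x * z1 y - z1 x * z3 y.
Proof.
rewrite /z1 /z3 !g8_eE // /g8_eps /wedge /=.
by apply/eqP; rewrite eq_complex /=; apply/andP; split; apply/eqP; ring.
Qed.

Lemma z2_lie x y : z2 (lie x y) = z2 x * z3 y - z3 x * z2 y.
Proof.
rewrite /z2 /z3 !g8_eE // /g8_eps /wedge /=.
by apply/eqP; rewrite eq_complex /=; apply/andP; split; apply/eqP; ring.
Qed.

Lemma z3_lie x y : z3 (lie x y) = 0.
Proof. by rewrite /z3 !g8_eE //= oppr0. Qed.

Definition z_lie := (z1_lie, z2_lie, z3_lie).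

Lemma cform1_coord (a : g8 R -> R[i]) x : cform1 a ->
  a x = (complex.Re (z1 x))%:C * a (vec 1 0 0)
      + (complex.Im (z1 x))%:C * a (vec 'i 0 0)
      + (complex.Re (z2 x))%:C * a (vec 0 1 0)
      + (complex.Im (z2 x))%:C * a (vec 0 'i 0)
      + (complex.Re (z3 x))%:C * a (vec 0 0 1)
      + (complex.Im (z3 x))%:C * a (vec 0 0 'i).
Proof.
move=> ha.
have {1}-> : x = complex.Re (z1 x) *: vec 1 0 0 + (complex.Im (z1 x) *: vec 'i 0 0
  + (complex.Re (z2 x) *: vec 0 1 0 + (complex.Im (z2 x) *: vec 0 'i 0
  + (complex.Re (z3 x) *: vec 0 0 1 + (complex.Im (z3 x) *: vec 0 0 'i + vec 0 0 0))))).
  by apply: z_inj; rewrite ?cform1_z1 ?cform1_z2 ?cform1_z3 !z_vec;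
    rewrite [LHS]complexE; ring.
have -> : vec 0 0 0 = 0 by apply/rowP => k; rewrite !mxE; case: k => [[|[|[|[|[|[|]]]]]]].
by rewrite !ha cform10 //; ring.
Qed.

End Coordinates.

Section DualBasis.
Variables (R : realType) (J : 'End(g8 R)).
Variables (w1 w2 w3 : g8 R -> R[i]) (u1 u2 u3 : g8 R).
Hypotheses (f1 : form10 J w1) (f2 : form10 J w2) (f3 : form10 J w3).
Hypotheses (w11 : w1 u1 = 1) (w12 : w1 u2 = 0) (w13 : w1 u3 = 0).
Hypotheses (w21 : w2 u1 = 0) (w22 : w2 u2 = 1) (w23 : w2 u3 = 0).
Hypotheses (w31 : w3 u1 = 0) (w32 : w3 u2 = 0) (w33 : w3 u3 = 1).

(** The six vectors [u_k], [J u_k] are independent, hence a basis of the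
six-dimensional real space. *)
Lemma dual_expansion x :
  x = complex.Re (w1 x) *: u1 + complex.Im (w1 x) *: J u1
    + complex.Re (w2 x) *: u2 + complex.Im (w2 x) *: J u2
    + complex.Re (w3 x) *: u3 + complex.Im (w3 x) *: J u3.
Proof.
pose X := [tuple u1; J u1; u2; J u2; u3; J u3] : 6.-tuple (g8 R).
have sumX (k : 'I_6 -> R) : \sum_(i < 6) k i *: X`_i =
    k (inord 0) *: u1 + k (inord 1) *: J u1 + k (inord 2) *: u2
    + k (inord 3) *: J u2 + k (inord 4) *: u3 + k (inord 5) *: J u3.
  have ki (i : 'I_6) : k i = k (inord i) by rewrite inord_val.
  rewrite !big_ord_recl big_ord0 addr0 /= !addrA.
  by do !congr (_ + _); congr (_ *: _); rewrite ki.
have coords (k : 'I_6 -> R) : let s := \sum_(i < 6) k i *: X`_i in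
    [/\ w1 s = k (inord 0) +i* k (inord 1), w2 s = k (inord 2) +i* k (inord 3)
      & w3 s = k (inord 4) +i* k (inord 5)].
  have l1 := form10_cform1 f1; have l2 := form10_cform1 f2.
  have l3 := form10_cform1 f3.
  rewrite /= sumX; split;
    rewrite !(cform1D _ _ l1, cform1Z _ _ l1, cform1D _ _ l2, cform1Z _ _ l2,
      cform1D _ _ l3, cform1Z _ _ l3, form10J _ f1, form10J _ f2, form10J _ f3);
    rewrite ?w11 ?w12 ?w13 ?w21 ?w22 ?w23 ?w31 ?w32 ?w33 [RHS]complexE /=; ring.
have freeX : free X.
  apply/freeP => k k0 i.
  have [] := coords k; rewrite k0.
  rewrite (cform10 (form10_cform1 f1)) (cform10 (form10_cform1 f2)).
  rewrite (cform10 (form10_cform1 f3)).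
  move=> [h0 h1] [h2 h3] [h4 h5].
  by rewrite -(inord_val i); case: i => [[|[|[|[|[|[|]]]]]]].
have basisX : basis_of fullv X.
  rewrite basisEfree freeX subvf /= dimvf.
  by have -> : dim (g8 R) = 6%N by exact: (dim_matrix R 1 6).
have xE := coord_basis basisX (memvf x).
have [h1 h2 h3] := coords (fun i => coord X i x).
rewrite -xE in h1 h2 h3.
by rewrite h1 h2 h3 /= -(sumX (fun i => coord X i x)).
Qed.

Lemma form10_dual_expansion a x : form10 J a ->
  a x = a u1 * w1 x + a u2 * w2 x + a u3 * w3 x.
Proof.
move=> fa; have la := form10_cform1 fa.
rewrite {1}(dual_expansion x) !(cform1D _ _ la, cform1Z _ _ la, form10J _ fa).
by rewrite [in RHS](complexE (w1 x)) [in RHS](complexE (w2 x))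
  [in RHS](complexE (w3 x)); ring.
Qed.

Lemma dual_basis10 : basis10 J w1 w2 w3.
Proof.
split=> // [a fa|c1 c2 c3 h].
  by exists (a u1), (a u2), (a u3) => x; exact: form10_dual_expansion.
have := h u1; have := h u2; have := h u3.
rewrite w11 w12 w13 w21 w22 w23 w31 w32 w33 !mulr0 !mulr1 !addr0 !add0r.
by [].
Qed.

End DualBasis.

(** * Complex structures with prescribed normal form *)

Section CoframeStructure.
Variables (R : realType) (g : lieAlgType R) (J : 'End(g)).

(** A normal form has no term of type (0,2), which is what the vanishing of the
Nijenhuis tensor means. *)
Lemma normal_form_integrable (lam mu k1 k2 : R[i]) (w1 w2 w3 : g -> R[i]) :
  form10 J w1 -> form10 J w2 -> form10 J w3 ->
  (forall x, w1 x = 0 -> w2 x = 0 -> w3 x = 0 -> x = 0) ->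
  normal_form lam mu k1 k2 w1 w2 w3 -> forall x y, nijenhuis J x y = 0.
Proof.
move=> f1 f2 f3 inj h x y.
have nij w : form10 J w -> w (nijenhuis J x y) =
    w (lie x y) + 'i * w (lie (J x) y) + 'i * w (lie x (J y))
    - w (lie (J x) (J y)).
  move=> f; have l := form10_cform1 f; rewrite /nijenhuis.
  by rewrite !(cform1D _ _ l) (cform1N _ l) !(form10J _ f).
have eE (a c : R[i]) : - a = c -> a = - c by move=> <-; rewrite opprK.
have [a1 a2 a3] := h x y; have [b1 b2 b3] := h (J x) y.
have [c1 c2 c3] := h x (J y); have [d1 d2 d3] := h (J x) (J y).
rewrite /wedge ?(form10J _ f1, form10J _ f2, form10J_conj _ f3, form10J _ f3)
  in a1 b1 c1 d1 a2 b2 c2 d2 a3 b3 c3 d3.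
apply: inj; rewrite nij //.
- rewrite (eE _ _ a1) (eE _ _ b1) (eE _ _ c1) (eE _ _ d1); ring: (sqr_i R).
- rewrite (eE _ _ a2) (eE _ _ b2) (eE _ _ c2) (eE _ _ d2); ring: (sqr_i R).
- rewrite (eE _ _ a3) (eE _ _ b3) (eE _ _ c3) (eE _ _ d3); ring.
Qed.
End CoframeStructure.

Section Model.
Variables (R : realType) (lam mu c1 c2 : R[i]).
Hypothesis lam_mu : lam * lam^* != mu * mu^*.
Implicit Types x y : g8 R.

(** The solution of [z3 = lam * w3 + mu * w3^*]. *)
Definition model_w3 x : R[i] :=
  (lam^* * z3 x - mu * (z3 x)^*) / (lam * lam^* - mu * mu^*).
(** The conjugate terms turn the weight equations into normal forms with
[k1 = c1 * lam] and [k2 = - c2 * lam]. *)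
Definition model_w1 x : R[i] := z1 x + c1 * (model_w3 x)^*.
Definition model_w2 x : R[i] := z2 x + c2 * (model_w3 x)^*.

Definition model_vec (a1 a2 a3 : R[i]) : g8 R :=
  vec (a1 - c1 * a3^*) (a2 - c2 * a3^*) (lam * a3 + mu * a3^*).

Let nu0 : lam * lam^* - mu * mu^* != 0.
Proof. by rewrite subr_eq0. Qed.

Let nuc : lam^* * lam - mu^* * mu != 0.
Proof. by rewrite mulrC [mu^* * _]mulrC. Qed.

Lemma z3_model x : z3 x = lam * model_w3 x + mu * (model_w3 x)^*.
Proof.
rewrite /model_w3 conjcM conjc_inv !conjcB !conjcM !conjcK.
by field; exact: nuc.
Qed.

Lemma model_vec3 a1 a2 a3 : model_w3 (model_vec a1 a2 a3) = a3.
Proof.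
rewrite /model_w3 z3_vec conjcD !conjcM conjcK; field; exact: nu0.
Qed.

Lemma model_vec1 a1 a2 a3 : model_w1 (model_vec a1 a2 a3) = a1.
Proof. by rewrite /model_w1 model_vec3 z1_vec subrK. Qed.

Lemma model_vec2 a1 a2 a3 : model_w2 (model_vec a1 a2 a3) = a2.
Proof. by rewrite /model_w2 model_vec3 z2_vec subrK. Qed.

Definition model_vecK := (model_vec1, model_vec2, model_vec3).

Lemma model_inj x y : model_w1 x = model_w1 y -> model_w2 x = model_w2 y ->
  model_w3 x = model_w3 y -> x = y.
Proof.
move=> + + h3; rewrite /model_w1 /model_w2 h3 => /addIr h1 /addIr h2.
by apply: z_inj => //; rewrite !z3_model h3.
Qed.

Let conjc_affine (c : R) (a b : R[i]) :
  (c%:C * a + b)^* = c%:C * a^* + b^*.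
Proof. by rewrite conjcD conjcM conjc_real. Qed.

Lemma cform1_model3 : cform1 model_w3.
Proof. by move=> c x y; rewrite /model_w3 cform1_z3 conjc_affine; ring. Qed.

Lemma cform1_model1 : cform1 model_w1.
Proof.
by move=> c x y; rewrite /model_w1 cform1_model3 cform1_z1 conjc_affine; ring.
Qed.

Lemma cform1_model2 : cform1 model_w2.
Proof.
by move=> c x y; rewrite /model_w2 cform1_model3 cform1_z2 conjc_affine; ring.
Qed.

Definition model_fun x : g8 R :=
  model_vec ('i * model_w1 x) ('i * model_w2 x) ('i * model_w3 x).

Fact model_fun_linear : linear model_fun.
Proof.
move=> c x y; rewrite /model_fun.
apply: model_inj; rewrite ?cform1_model1 ?cform1_model2 ?cform1_model3
  !model_vecK ?cform1_model1 ?cform1_model2 ?cform1_model3; ring.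
Qed.

HB.instance Definition _ :=
  GRing.isLinear.Build R (g8 R) (g8 R) *:%R model_fun model_fun_linear.

Definition model_J : 'End(g8 R) := linfun model_fun.

Lemma model_form1 : form10 model_J model_w1.
Proof. by split=> [|x]; [exact: cform1_model1 | rewrite lfunE model_vec1]. Qed.

Lemma model_form2 : form10 model_J model_w2.
Proof. by split=> [|x]; [exact: cform1_model2 | rewrite lfunE model_vec2]. Qed.

Lemma model_form3 : form10 model_J model_w3.
Proof. by split=> [|x]; [exact: cform1_model3 | rewrite lfunE model_vec3]. Qed.

Lemma model_normal_form :
  normal_form lam mu (c1 * lam) (- (c2 * lam)) model_w1 model_w2 model_w3.
Proof.
move=> x y; rewrite /ce_d1 /wedge {1}/model_w1 {1}/model_w2.
have -> : model_w3 (lie x y) = 0.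
  by rewrite /model_w3 z3_lie conjc0 !mulr0 subr0 mul0r.
rewrite conjc0 !mulr0 !addr0 z1_lie z2_lie !z3_model.
have h1 v : z1 v = model_w1 v - c1 * (model_w3 v)^* by rewrite addrK.
have h2 v : z2 v = model_w2 v - c2 * (model_w3 v)^* by rewrite addrK.
by rewrite !h1 !h2; split; ring.
Qed.

Lemma model_complex_structure : complex_structure model_J.
Proof.
have J2 x : model_J (model_J x) = - x.
  have ii (a : R[i]) : 'i * ('i * a) = - a by ring: (sqr_i R).
  apply: model_inj.
  - by rewrite !(form10J _ model_form1) ii (cform1N _ cform1_model1).
  - by rewrite !(form10J _ model_form2) ii (cform1N _ cform1_model2).
  - by rewrite !(form10J _ model_form3) ii (cform1N _ cform1_model3).
split=> //.
apply: (normal_form_integrable model_form1 model_form2 model_form3 _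
  model_normal_form) => x h1 h2 h3.
by apply: model_inj; rewrite ?h1 ?h2 ?h3 cform10 //;
  [exact: cform1_model1|exact: cform1_model2|exact: cform1_model3].
Qed.

Lemma model_basis10 : basis10 model_J model_w1 model_w2 model_w3.
Proof.
by apply: (dual_basis10 model_form1 model_form2 model_form3
  (u1 := model_vec 1 0 0) (u2 := model_vec 0 1 0) (u3 := model_vec 0 0 1));
  rewrite model_vecK.
Qed.

End Model.

(** For [J] and [J'] the weight is [2 i w3], so [c1] and [c2] are [+- 1 / (2 i)]
or zero. *)
Lemma label_realized (R : realType) (l : g8_label R) : valid_label l ->
  exists J : 'End(g8 R), complex_structure J /\ has_reduced_equations l J.
Proof.
move=> vl; have lm := valid_label_norm vl.
have [c1 [c2 [h1 h2]]] : exists c1 c2, label_k1 l = c1 * label_lam l /\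
    label_k2 l = - (c2 * label_lam l).
  case: l {vl lm} => [||A] /=.
  - by exists (2 * 'i)^-1, 0; rewrite mulVf ?mulf_neq0 ?two_neq0 ?i_neq0 // mul0r oppr0.
  - exists (2 * 'i)^-1, (- (2 * 'i)^-1).
    by rewrite mulNr mulVf ?mulf_neq0 ?two_neq0 ?i_neq0 // opprK.
  - by exists 0, 0; rewrite !mul0r oppr0.
exists (model_J (label_lam l) (label_mu l) c1 c2); split.
  exact: model_complex_structure.
exists (model_w1 (label_lam l) (label_mu l) c1),
  (model_w2 (label_lam l) (label_mu l) c2),
  (model_w3 (label_lam l) (label_mu l)); split; first exact: model_basis10.
by apply/reduced_equationsE; rewrite h1 h2; exact: model_normal_form.
Qed.

(** * Closed volume forms *)

Section VolumeForm.
Variables (R : realType) (J : 'End(g8 R)).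
Variable psi : g8 R -> g8 R -> g8 R -> R[i].
Hypotheses (psi30 : form30 J psi) (psi_neq0 : exists x y z, psi x y z != 0).
Implicit Types x y z t : g8 R.

Let psi3 : cform3 psi := psi30.1.
Let f1 y z : form10 J (fun x => psi x y z) := form30_1 y z psi30.
Let f2 x z : form10 J (fun y => psi x y z) := form30_2 x z psi30.
Let f3 x y : form10 J (fun z => psi x y z) := form30_3 x y psi30.
Let l1 y z := form10_cform1 (f1 y z).
Let l2 x z := form10_cform1 (f2 x z).
Let l3 x y := form10_cform1 (f3 x y).
Let alt12 x z : psi x x z = 0. Proof. by case: psi3. Qed.
Let alt23 x y : psi x y y = 0. Proof. by case: psi3. Qed.
Let swap12 x y z : psi x y z = - psi y x z := form30_swap12 x y z psi3.
Let swap23 x y z : psi x y z = - psi x z y := form30_swap23 x y z psi3.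
Let alt13 x y : psi x y x = 0.
Proof. by rewrite swap23 alt12 oppr0. Qed.

Local Notation e1 := (vec 1 0 0 : g8 R).
Local Notation e2 := (vec 'i 0 0 : g8 R).
Local Notation e3 := (vec 0 1 0 : g8 R).
Local Notation e4 := (vec 0 'i 0 : g8 R).
Local Notation e5 := (vec 0 0 'i : g8 R).
Local Notation e6 := (vec 0 0 1 : g8 R).

(** A (3,0)-form is a multiple of the determinant in a (1,0)-coframe, hence its
contraction with [c] is decomposable and satisfies the Plücker relation. *)
Lemma volume_plucker x y z t c :
  psi x y c * psi z t c - psi x z c * psi y t c + psi x t c * psi y z c = 0.
Proof.
have [u1 [u2 [u3 k0]]] := psi_neq0; set k := psi u1 u2 u3 in k0.
have sc w (h : form10 J w) := form10_scale k^-1 h.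
have rot x' y' z' : psi x' y' z' = psi z' x' y'.
  by rewrite swap23 swap12 opprK.
pose w1 v := k^-1 * psi v u2 u3; pose w2 v := k^-1 * psi u1 v u3.
pose w3 v := k^-1 * psi u1 u2 v.
have ex a v : form10 J a -> a v = a u1 * w1 v + a u2 * w2 v + a u3 * w3 v.
  by apply: form10_dual_expansion; try exact: sc;
    rewrite /w1 /w2 /w3 ?alt12 ?alt23 ?alt13 ?mulr0 ?mulVf.
have det a b v : psi a b v = k * (w1 a * (w2 b * w3 v - w3 b * w2 v)
    - w2 a * (w1 b * w3 v - w3 b * w1 v) + w3 a * (w1 b * w2 v - w2 b * w1 v)).
  rewrite (ex _ a (f1 b v)) (ex _ b (f2 u1 v)) (ex _ b (f2 u2 v)).
  rewrite (ex _ b (f2 u3 v)) !alt12.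
  rewrite (ex _ v (f3 u1 u2)) (ex _ v (f3 u1 u3)) (ex _ v (f3 u2 u3)).
  rewrite (ex _ v (f3 u2 u1)) (ex _ v (f3 u3 u1)) (ex _ v (f3 u3 u2)).
  rewrite !alt13 !alt23.
  have -> : psi u1 u3 u2 = - k by rewrite swap23.
  have -> : psi u2 u3 u1 = k by rewrite rot.
  have -> : psi u2 u1 u3 = - k by rewrite swap12.
  have -> : psi u3 u1 u2 = k by rewrite -rot.
  have -> : psi u3 u2 u1 = - k by rewrite swap12 -rot swap12 opprK.
  by rewrite -/k; ring.
by rewrite !det; ring.
Qed.

Lemma cform1_eq0 (a : g8 R -> R[i]) : cform1 a ->
  a e1 = 0 -> a e2 = 0 -> a e3 = 0 -> a e4 = 0 -> a e5 = 0 -> a e6 = 0 ->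
  forall x, a x = 0.
Proof.
by move=> la h1 h2 h3 h4 h5 h6 x; rewrite (cform1_coord x la) h1 h2 h3 h4 h5 h6;
  ring.
Qed.

(** A (1,0)-form cannot be a complex multiple of a real form, so one that
factors through the plane spanned by [e5] and [e6] vanishes with its value at
[e6]. *)
Lemma form10_eq0 (a : g8 R -> R[i]) : form10 J a ->
  a e1 = 0 -> a e2 = 0 -> a e3 = 0 -> a e4 = 0 -> a e6 = 0 ->
  forall x, a x = 0.
Proof.
move=> fa h1 h2 h3 h4 h6; apply: (form10_real_multiple_eq0 (k := a e5)
  (r := fun x => complex.Im (z3 x)) fa) => x.
by rewrite (cform1_coord x (form10_cform1 fa)) h1 h2 h3 h4 h6; ring.
Qed.

Hypothesis psi_closed : forall x0 x1 x2 x3, ce_d3 psi x0 x1 x2 x3 = 0.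

Let p1 y z : psi 0 y z = 0 := cform10 (l1 y z).

Lemma lie_ideal x y : z3 x = 0 -> z3 y = 0 -> lie x y = 0.
Proof.
move=> hx hy; apply: z_inj;
  rewrite z_lie ?hx ?hy ?(cform10 (@cform1_z1 R)) ?(cform10 (@cform1_z2 R))
    ?(cform10 (@cform1_z3 R)) //; ring.
Qed.

(** On the abelian ideal, [ad e6] has eigenvalues [1] and [-1], so it acts on
trilinear forms with odd, hence nonzero, eigenvalues; but it kills [psi]. *)
Lemma volume_ideal x y z : z3 x = 0 -> z3 y = 0 -> z3 z = 0 -> psi x y z = 0.
Proof.
move=> hx hy hz.
pose s v := lie v e6.
have s3 v : z3 (s v) = 0 by rewrite z_lie.
have ss v : z3 v = 0 -> s (s v) = v.
  by move=> hv; apply: z_inj; rewrite ?z_lie ?z_vec ?z_lie ?z_vec ?hv //; ring.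
have H a b c : z3 a = 0 -> z3 b = 0 -> z3 c = 0 ->
    psi (s a) b c + psi a (s b) c + psi a b (s c) = 0.
  move=> ha hb hc; have := psi_closed a b c e6; rewrite /ce_d3.
  rewrite (lie_ideal ha hb) (lie_ideal ha hc) (lie_ideal hb hc) !p1.
  rewrite (swap12 a (s b)) (swap23 a b) (swap12 a (s c)) -/(s a) -/(s b) -/(s c).
  move=> h; apply: (eq_of_multiple (k := -1) h); ring.
have h1 := H _ _ _ (s3 x) hy hz; have h2 := H _ _ _ hx (s3 y) hz.
have h3 := H _ _ _ hx hy (s3 z); have h4 := H _ _ _ (s3 x) (s3 y) (s3 z).
rewrite !ss // in h1 h2 h3 h4.
(* The three values of [psi] on [x], [y], [z] with two of them moved by [s],
   together with [psi x y z], satisfy four linear relations. *)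
suff key (a b c d : R[i]) : a + b + c = 0 -> b + a + d = 0 -> c + d + a = 0 ->
    d + c + b = 0 -> a = 0 by exact: key h1 h2 h3 h4.
move=> k1 k2 k3 k4; have three : (3 : R[i]) != 0 by rewrite pnatr_eq0.
apply: (mulfI three); rewrite mulr0.
transitivity ((a + b + c) + (b + a + d) + (c + d + a) - 2 * (d + c + b)).
  by ring.
by rewrite k1 k2 k3 k4; ring.
Qed.

Let ideal_vec p q p' q' p'' q'' :
  psi (vec p q 0) (vec p' q' 0) (vec p'' q'' 0) = 0.
Proof. by rewrite volume_ideal ?z3_vec. Qed.

(** The weight equations on [Lambda^2] of the ideal, read off from
[d psi (x, y, e6, e5) = 0]. *)
Lemma volume_weight2 x y : z3 x = 0 -> z3 y = 0 ->
  psi (lie x e6) y e5 + psi x (lie y e6) e5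
  = psi (lie x e5) y e6 + psi x (lie y e5) e6.
Proof.
move=> hx hy; have := psi_closed x y e6 e5; rewrite /ce_d3 (lie_ideal hx hy).
have -> : lie e6 e5 = 0.
  by apply: z_inj; rewrite z_lie ?z_vec ?(cform10 (@cform1_z1 R))
    ?(cform10 (@cform1_z2 R)) ?(cform10 (@cform1_z3 R)) //; ring.
rewrite !p1 (swap12 x (lie y e6)) (swap12 x (lie y e5)) => h.
by apply: (eq_of_multiple (k := 1) h); ring.
Qed.

Let lie_e : [/\ lie e1 e6 = - e1, lie e2 e6 = - e2, lie e3 e6 = e3 &
  lie e4 e6 = e4].
Proof.
by split; apply: z_inj; rewrite ?z_lie ?(cform1N _ (@cform1_z1 R))
  ?(cform1N _ (@cform1_z2 R)) ?(cform1N _ (@cform1_z3 R)) !z_vec; ring.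
Qed.

Let lie_e' : [/\ lie e1 e5 = - e2, lie e2 e5 = e1, lie e3 e5 = e4 &
  lie e4 e5 = - e3].
Proof.
by split; apply: z_inj; rewrite ?z_lie ?(cform1N _ (@cform1_z1 R))
  ?(cform1N _ (@cform1_z2 R)) ?(cform1N _ (@cform1_z3 R)) !z_vec;
  ring: (sqr_i R).
Qed.

Let psiN1 x y z : psi (- x) y z = - psi x y z := cform1N x (l1 y z).
Let psiN2 x y z : psi x (- y) z = - psi x y z := cform1N y (l2 x z).

(** On [e1], [e2] the relation for [e6], [e5] reads [2 psi e1 e2 e5 = 0]; this
leaves a real multiple of [psi e1 e2 e6]. *)
Lemma volume_12 t : psi e1 e2 t = 0.
Proof.
have h5 : psi e1 e2 e5 = 0.
  have := volume_weight2 (z3_vec 1 0 0) (z3_vec 'i 0 0).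
  have [-> -> _ _] := lie_e; have [-> -> _ _] := lie_e'.
  rewrite ?psiN1 ?psiN2 !alt12 => h; apply: (mulfI (two_neq0 R)).
  by apply: (eq_of_multiple (k := -1) h); ring.
move: t; apply: (form10_real_multiple_eq0 (k := psi e1 e2 e6)
  (r := fun t => complex.Re (z3 t)) (f3 e1 e2)) => t.
rewrite (cform1_coord t (l3 e1 e2)) !ideal_vec h5; ring.
Qed.

Lemma volume_34 t : psi e3 e4 t = 0.
Proof.
have h5 : psi e3 e4 e5 = 0.
  have := volume_weight2 (z3_vec 0 1 0) (z3_vec 0 'i 0).
  have [_ _ -> ->] := lie_e; have [_ _ -> ->] := lie_e'.
  rewrite ?psiN1 ?psiN2 !alt12 => h; apply: (mulfI (two_neq0 R)).
  by apply: (eq_of_multiple (k := 1) h); ring.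
move: t; apply: (form10_real_multiple_eq0 (k := psi e3 e4 e6)
  (r := fun t => complex.Re (z3 t)) (f3 e3 e4)) => t.
rewrite (cform1_coord t (l3 e3 e4)) !ideal_vec h5; ring.
Qed.

(** The two sides differ by a (1,0)-form that factors through [z3] and vanishes
at [e6], where the weights of the two planes cancel. *)
Lemma volume_23 t : psi e2 e3 t = psi e1 e4 t.
Proof.
apply/eqP; rewrite -subr_eq0; apply/eqP; move: t.
have fa : form10 J (fun t => psi e2 e3 t - psi e1 e4 t).
  have := form10_comb 1 (-1) (f3 e2 e3) (f3 e1 e4).
  by case=> h1 h2; split=> [c x y|x]; [have := h1 c x y | have := h2 x];
    rewrite !mul1r !mulN1r.
apply: (form10_eq0 fa); rewrite ?ideal_vec ?subrr //.
have := volume_weight2 (z3_vec 1 0 0) (z3_vec 0 1 0).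
have [-> _ -> _] := lie_e; have [-> _ -> _] := lie_e'.
by rewrite ?psiN1 => h; apply: (eq_of_multiple (k := 1) h); ring.
Qed.

Lemma volume_24 t : psi e2 e4 t = - psi e1 e3 t.
Proof.
apply/eqP; rewrite -subr_eq0 opprK; apply/eqP; move: t.
have fa : form10 J (fun t => psi e2 e4 t + psi e1 e3 t).
  have := form10_comb 1 1 (f3 e2 e4) (f3 e1 e3).
  by case=> h1 h2; split=> [c x y|x]; [have := h1 c x y | have := h2 x];
    rewrite !mul1r.
apply: (form10_eq0 fa); rewrite ?ideal_vec ?addr0 //.
have := volume_weight2 (z3_vec 1 0 0) (z3_vec 0 'i 0).
have [-> _ _ ->] := lie_e; have [-> _ _ ->] := lie_e'.
by rewrite ?psiN1 ?psiN2 => h; apply: (eq_of_multiple (k := 1) h); ring.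
Qed.

(** By the preceding lemmas the Plücker relation on [e1], [e2], [e3], [e4] reads
[(psi e1 e3 t)^2 + (psi e1 e4 t)^2 = 0]. *)
Lemma volume_ratio t :
  psi e1 e4 t = 'i * psi e1 e3 t \/ psi e1 e4 t = - 'i * psi e1 e3 t.
Proof.
have := volume_plucker e1 e2 e3 e4 t.
rewrite volume_12 volume_24 volume_23 mul0r => h.
have /eqP : (psi e1 e4 t - 'i * psi e1 e3 t) * (psi e1 e4 t + 'i * psi e1 e3 t)
  = 0 by rewrite -[RHS]h; ring: (sqr_i R).
by rewrite mulf_eq0 subr_eq0 addr_eq0 -mulNr => /orP[] /eqP; [left|right].
Qed.

(** Otherwise [psi] would vanish as soon as two arguments lie in the ideal, so
[x |-> psi a x e6] would be a real form times [psi a e5 e6] for [a] in the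
ideal, hence zero; then [psi] itself would be zero. *)
Lemma volume_13_neq0 : exists t, psi e1 e3 t != 0.
Proof.
apply: contrapT => no; have b0 t : psi e1 e3 t = 0.
  by apply/eqP/negPn/negP => h; apply: no; exists t.
have h14 t : psi e1 e4 t = 0 by have [->|->] := volume_ratio t; rewrite b0 mulr0.
have h23 t := etrans (volume_23 t) (h14 t).
have h24 t : psi e2 e4 t = 0 by rewrite volume_24 b0 oppr0.
have neg0 a b t : psi a b t = 0 -> psi b a t = 0.
  by move=> h; rewrite swap12 h oppr0.
have zero_slot a : (forall t, psi a e1 t = 0) -> (forall t, psi a e2 t = 0) ->
    (forall t, psi a e3 t = 0) -> (forall t, psi a e4 t = 0) ->
    forall b t, psi a b t = 0.
  move=> k1 k2 k3 k4.
  have h6 b : psi a b e6 = 0.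
    by move: b; apply: (form10_eq0 (f2 a e6)).
  have h5 b : psi a b e5 = 0.
    by apply: (cform1_eq0 (l2 a e5)) => //; rewrite swap23 h6 oppr0.
  move=> b t; move: t; apply: (cform1_eq0 (l3 a b)) => //;
    by rewrite swap23 ?k1 ?k2 ?k3 ?k4 oppr0.
have y1 : forall b t, psi e1 b t = 0 by apply: zero_slot => // t; exact: volume_12.
have y2 : forall b t, psi e2 b t = 0.
  by apply: zero_slot => // t; apply: neg0.
have y3 : forall b t, psi e3 b t = 0.
  by apply: zero_slot => // t; [apply: neg0.. | exact: volume_34].
have y4 : forall b t, psi e4 b t = 0.
  by apply: zero_slot => // t; apply: neg0 => //; exact: volume_34.
have [x [y [t /eqP]]] := psi_neq0; apply.
have y6 b c : psi e6 b c = 0.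
  move: c; apply: (form10_eq0 (f3 e6 b)); rewrite ?alt13 //;
    by rewrite swap23 swap12 opprK ?y1 ?y2 ?y3 ?y4.
by move: x; apply: (form10_eq0 (f1 y t)).
Qed.

End VolumeForm.

(** * From closed volume forms to reduced equations *)

Section Frame.
Variables (R : realType) (J : 'End(g8 R)).
Variable psi : g8 R -> g8 R -> g8 R -> R[i].
Hypothesis psi30 : form30 J psi.
Implicit Types x y z t : g8 R.

(** [zeta1], [zeta2], [zeta3] stand for [z1], [z2], [z3] or for their
conjugates, according to the sign of [J] on the ideal. *)
Variables zeta1 zeta2 zeta3 : g8 R -> R[i].
Hypotheses (l1 : cform1 zeta1) (l2 : cform1 zeta2) (l3 : cform1 zeta3).
Hypothesis lie1 : forall x y,
  zeta1 (lie x y) = zeta3 x * zeta1 y - zeta1 x * zeta3 y.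
Hypothesis lie2 : forall x y,
  zeta2 (lie x y) = zeta2 x * zeta3 y - zeta3 x * zeta2 y.
Hypothesis lie3 : forall x y, zeta3 (lie x y) = 0.

(* [ju1] and [ju2] turn out to be [J u1] and [J u2]. *)
Variables (u1 u2 ju1 ju2 v1 v2 : g8 R).
Hypotheses (zu1 : [/\ zeta1 u1 = 1, zeta2 u1 = 0 & zeta3 u1 = 0]).
Hypotheses (zu2 : [/\ zeta1 u2 = 0, zeta2 u2 = 1 & zeta3 u2 = 0]).
Hypotheses (zju1 : [/\ zeta1 ju1 = 'i, zeta2 ju1 = 0 & zeta3 ju1 = 0]).
Hypotheses (zju2 : [/\ zeta1 ju2 = 0, zeta2 ju2 = 'i & zeta3 ju2 = 0]).
Hypotheses (zv1 : zeta3 v1 = 1) (zv2 : zeta3 v2 = 'i).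

Variables (c : g8 R) (b : R[i]).
Hypothesis b0 : b != 0.
Hypothesis psi_c : forall x y, zeta3 x = 0 -> zeta3 y = 0 ->
  psi x y c = b * (zeta1 x * zeta2 y - zeta2 x * zeta1 y).
Hypothesis psi_ideal : forall x y z, zeta3 x = 0 -> zeta3 y = 0 ->
  zeta3 z = 0 -> psi x y z = 0.

(** Contracting [psi] with two of [u1], [u2], [c] gives (1,0)-forms [w1], [w2],
[w3] dual to these vectors; [w1], [w2] restrict to [zeta1], [zeta2] on the ideal
and [w3] vanishes there. So [w1 - zeta1], [w2 - zeta2] and [zeta3] are
combinations of [w3] and its conjugate, and the differentials of [zeta1],
[zeta2] translate into the normal form. *)
Lemma frame_normal_form : exists lam mu k1 k2 w1 w2 w3,
  [/\ basis10 J w1 w2 w3, normal_form lam mu k1 k2 w1 w2 w3 &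
      lam * lam^* != mu * mu^*].
Proof.
have [z11 z21 z31] := zu1; have [z12 z22 z32] := zu2.
have [y11 y21 y31] := zju1; have [y12 y22 y32] := zju2.
have [_ _ _ alt12 alt23] := psi30.1.
pose w1 x := b^-1 * psi x u2 c; pose w2 x := b^-1 * psi u1 x c.
pose w3 x := b^-1 * psi u1 u2 x.
have f1 : form10 J w1 by exact: form10_scale (form30_1 _ _ psi30).
have f2 : form10 J w2 by exact: form10_scale (form30_2 _ _ psi30).
have f3 : form10 J w3 by exact: form10_scale (form30_3 _ _ psi30).
have [lw1 lw2 lw3] := And3 (form10_cform1 f1) (form10_cform1 f2) (form10_cform1 f3).
have w1E x : zeta3 x = 0 -> w1 x = zeta1 x.
  by move=> hx; rewrite /w1 psi_c // z12 z22; field.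
have w2E x : zeta3 x = 0 -> w2 x = zeta2 x.
  by move=> hx; rewrite /w2 psi_c // z11 z21; field.
have w3E x : zeta3 x = 0 -> w3 x = 0.
  by move=> hx; rewrite /w3 psi_ideal // mulr0.
have w1c : w1 c = 0 by rewrite /w1 (form30_swap12 _ _ _ psi30.1) alt23 oppr0 mulr0.
have w2c : w2 c = 0 by rewrite /w2 alt23 mulr0.
have w3c : w3 c = 1 by rewrite /w3 psi_c // z11 z21 z12 z22; field.
have [w11 w21 w31] : [/\ w1 u1 = 1, w2 u1 = 0 & w3 u1 = 0].
  by rewrite w1E ?w2E ?w3E.
have [w12 w22 w32] : [/\ w1 u2 = 0, w2 u2 = 1 & w3 u2 = 0].
  by rewrite w1E ?w2E ?w3E.
have dual := dual_expansion f1 f2 f3 w11 w12 w1c w21 w22 w2c w31 w32 w3c.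
have ju1E : J u1 = ju1.
  by rewrite (dual ju1) w1E // w2E // w3E // y11 y21 /= !scale0r scale1r !addr0 add0r.
have ju2E : J u2 = ju2.
  by rewrite (dual ju2) w1E // w2E // w3E // y12 y22 /= !scale0r scale1r !addr0 !add0r.
(* A form vanishing on the ideal is a combination of [w3] and its conjugate. *)
have mod_ideal a : cform1 a -> a u1 = 0 -> a u2 = 0 -> a ju1 = 0 -> a ju2 = 0 ->
    forall x, a x = (a c - 'i * a (J c)) / 2 * w3 x
      + (a c + 'i * a (J c)) / 2 * (w3 x)^*.
  move=> la a1 a2 a3 a4 x.
  rewrite [in LHS](dual x) !(cform1D _ _ la, cform1Z _ _ la) ju1E ju2E a1 a2 a3 a4.
  have := complexE (w3 x); have := conjcE (w3 x).
  move: (complex.Re _) (complex.Im _) => p q -> ->.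
  by field: (sqr_i R).
have [lam [mu hz3]] : exists lam mu, forall x,
    zeta3 x = lam * w3 x + mu * (w3 x)^*.
  by do 2!eexists; apply: mod_ideal.
have [d1' [d1 hz1]] : exists d' d, forall x,
    w1 x - zeta1 x = d' * w3 x + d * (w3 x)^*.
  do 2!eexists; apply: (mod_ideal (fun x => w1 x - zeta1 x)) => [k x y||||];
    by [rewrite lw1 l1; ring | rewrite w1E ?subrr].
have [d2' [d2 hz2]] : exists d' d, forall x,
    w2 x - zeta2 x = d' * w3 x + d * (w3 x)^*.
  do 2!eexists; apply: (mod_ideal (fun x => w2 x - zeta2 x)) => [k x y||||];
    by [rewrite lw2 l2; ring | rewrite w2E ?subrr].
exists lam, mu, (d1 * lam - d1' * mu), (- (d2 * lam - d2' * mu)), w1, w2, w3; split.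
- exact: dual_basis10 f1 f2 f3 w11 w12 w1c w21 w22 w2c w31 w32 w3c.
- move=> x y; rewrite /ce_d1 /wedge.
  rewrite (w1E _ (lie3 x y)) (w2E _ (lie3 x y)) (w3E _ (lie3 x y)) lie1 lie2 !hz3.
  have e1 t : zeta1 t = w1 t - (d1' * w3 t + d1 * (w3 t)^*) by rewrite -hz1; ring.
  have e2 t : zeta2 t = w2 t - (d2' * w3 t + d2 * (w3 t)^*) by rewrite -hz2; ring.
  by rewrite !e1 !e2; split; ring.
(* If the moduli agreed, [zeta3] and its conjugate would be proportional. *)
apply/eqP => lm.
have prop x : lam * (zeta3 x)^* = mu^* * zeta3 x.
  rewrite hz3 conjcD (conjcM lam) (conjcM mu) conjcK.
  by apply: (eq_of_multiple (k := (w3 x)^*) lm); ring.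
have := prop v1; have := prop v2; rewrite zv1 zv2 conjc1 conjc_i !mulr1 => h2 h1.
have lam0 : lam = 0.
  apply: (mulfI (two_neq0 R)); apply: (mulfI (i_neq0 R)).
  by apply: (eq_of_multiples (k := - 1) (m := 'i) h2 h1); ring.
have mu0 : mu = 0 by apply/eqP; rewrite -conjc_eq0 -h1 lam0.
by move: zv1; rewrite hz3 lam0 mu0 !mul0r addr0 => /esym/eqP; rewrite oner_eq0.
Qed.

End Frame.

Section Classification.
Variables (R : realType) (J : 'End(g8 R)).

Lemma volume_form_normal_form : has_closed_volume_form J ->
  exists lam mu k1 k2 w1 w2 w3,
    [/\ basis10 J w1 w2 w3, normal_form lam mu k1 k2 w1 w2 w3 &
        lam * lam^* != mu * mu^*].
Proof.
case=> psi [psi30 nz closed].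
have [c b0] := volume_13_neq0 psi30 nz closed.
have [l1 l2 l3] : [/\ cform1 (@z1 R), cform1 (@z2 R) & cform1 (@z3 R)].
  by split; [exact: cform1_z1 | exact: cform1_z2 | exact: cform1_z3].
have conj_cform1 (a : g8 R -> R[i]) : cform1 a -> cform1 (fun x => (a x)^*).
  by move=> la k x y; rewrite la conjcD conjcM conjc_real.
have psi_c x y : z3 x = 0 -> z3 y = 0 -> psi x y c =
    ((complex.Re (z1 x))%:C * (complex.Re (z2 y))%:C
     - (complex.Im (z1 x))%:C * (complex.Im (z2 y))%:C
     - (complex.Re (z1 y))%:C * (complex.Re (z2 x))%:C
     + (complex.Im (z1 y))%:C * (complex.Im (z2 x))%:C)
      * psi (vec 1 0 0) (vec 0 1 0) c
    + ((complex.Re (z1 x))%:C * (complex.Im (z2 y))%:C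
     + (complex.Im (z1 x))%:C * (complex.Re (z2 y))%:C
     - (complex.Re (z1 y))%:C * (complex.Im (z2 x))%:C
     - (complex.Im (z1 y))%:C * (complex.Re (z2 x))%:C)
      * psi (vec 1 0 0) (vec 0 'i 0) c.
  move=> hx hy; have [k1 k2 _ alt _] := psi30.1.
  have sw := form30_swap12 _ _ _ psi30.1.
  rewrite (cform1_coord x (k1 y c)) hx !(cform1_coord y (k2 _ c)) hy !alt /=.
  rewrite (sw (vec 'i 0 0) (vec 1 0 0)) (sw (vec 0 1 0) (vec 1 0 0)).
  rewrite (sw (vec 0 'i 0) (vec 1 0 0)) (sw (vec 0 1 0) (vec 'i 0 0)).
  rewrite (sw (vec 0 'i 0) (vec 'i 0 0)) (sw (vec 0 'i 0) (vec 0 1 0)).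
  rewrite (volume_12 psi30 closed) (volume_34 psi30 closed).
  rewrite (volume_23 psi30 closed) (volume_24 psi30 closed).
  by ring.
have [h14|h14] := volume_ratio psi30 nz closed c.
- apply: (frame_normal_form psi30 l1 l2 l3 (@z1_lie R) (@z2_lie R) (@z3_lie R)
    (u1 := vec 1 0 0) (u2 := vec 0 1 0) (ju1 := vec 'i 0 0) (ju2 := vec 0 'i 0)
    (v1 := vec 0 0 1) (v2 := vec 0 0 'i) (c := c) _ _ _ _ _ _ b0);
    rewrite ?z_vec //.
  + move=> x y hx hy; rewrite psi_c // h14.
    rewrite (_ : z1 x * z2 y - z2 x * z1 y =
      ((complex.Re (z1 x))%:C + 'i * (complex.Im (z1 x))%:C)
      * ((complex.Re (z2 y))%:C + 'i * (complex.Im (z2 y))%:C)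
      - ((complex.Re (z2 x))%:C + 'i * (complex.Im (z2 x))%:C)
      * ((complex.Re (z1 y))%:C + 'i * (complex.Im (z1 y))%:C)); last first.
      by rewrite -!complexE.
    by ring: (sqr_i R).
  + by move=> x y z; exact: (volume_ideal psi30 closed).
- pose cj (a : g8 R -> R[i]) x := (a x)^*.
  have conj0 a x : cj a x = 0 -> a x = 0.
    by move=> /eqP; rewrite conjc_eq0 => /eqP.
  have conjNi : (- 'i : R[i])^* = 'i by rewrite -conjc_i conjcK.
  apply: (@frame_normal_form _ _ _ psi30 (cj (@z1 R)) (cj (@z2 R)) (cj (@z3 R))
    (conj_cform1 _ l1) (conj_cform1 _ l2) (conj_cform1 _ l3) _ _ _
    (vec 1 0 0) (vec 0 1 0) (vec (- 'i) 0 0) (vec 0 (- 'i) 0)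
    (vec 0 0 1) (vec 0 0 (- 'i)) _ _ _ _ _ _ c _ b0);
    rewrite /cj ?z_vec ?conjc0 ?conjc1 ?conjNi //.
  + by move=> x y; rewrite z1_lie conjcB !conjcM.
  + by move=> x y; rewrite z2_lie conjcB !conjcM.
  + by move=> x y; rewrite z3_lie conjc0.
  + move=> x y /conj0 hx /conj0 hy; rewrite psi_c // h14 !conjcE.
    by ring: (sqr_i R).
  + by move=> x y z /conj0 hx /conj0 hy /conj0 hz; exact: (volume_ideal psi30 closed).
Qed.

End Classification.

Lemma isomorphic_reduced_equations (R : realType) (g : lieAlgType R) (l : g8_label R)
    (J1 J2 : 'End(g)) :
  isomorphic_cs J1 J2 -> has_reduced_equations l J2 ->
  has_reduced_equations l J1.
Proof.
case=> F [[[G GF FG] Flie] FJ] [w1 [w2 [w3 [[f1 f2 f3 sp ind] red]]]].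
have pull w : form10 J2 w -> form10 J1 (w \o F).
  case=> lw jw; split=> [c x y|x] /=; first by rewrite linearP lw.
  by rewrite FJ jw.
have push a : form10 J1 a -> form10 J2 (a \o G).
  have Finj := can_inj GF.
  case=> la ja; split=> [c x y|x] /=.
    by rewrite -la; congr (a _); apply: Finj; rewrite linearP /= !FG.
  transitivity (a (J1 (G x))); last exact: ja.
  by congr (a _); apply: Finj; rewrite FJ !FG.
exists (w1 \o F), (w2 \o F), (w3 \o F); split.
  split; [exact: pull|exact: pull|exact: pull| |].
    move=> a /push/sp [c1 [c2 [c3 h]]]; exists c1, c2, c3 => x.
    by rewrite /= -h /= GF.
  by move=> c1 c2 c3 h; apply: ind => x; rewrite -[x]FG; exact: h.
move: red => /reduced_equationsE red; apply/reduced_equationsE => x y.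
have := red (F x) (F y); rewrite /ce_d1 /wedge /= -Flie; exact.
Qed.

Theorem proposition3p7 (R : realType) :
  (forall J : 'End(g8 R),
     complex_structure J -> has_closed_volume_form J ->
     exists l : g8_label R, valid_label l /\ has_reduced_equations l J)
  /\ (forall l : g8_label R, valid_label l ->
        exists J : 'End(g8 R),
          complex_structure J /\ has_reduced_equations l J)
  /\ (forall (l1 l2 : g8_label R) (J1 J2 : 'End(g8 R)),
        valid_label l1 -> valid_label l2 ->
        complex_structure J1 -> complex_structure J2 ->
        has_reduced_equations l1 J1 -> has_reduced_equations l2 J2 ->
        l1 <> l2 -> ~ isomorphic_cs J1 J2).
Proof.
split; [|split].
- move=> J _ /volume_form_normal_form [lam [mu [k1 [k2 [w1 [w2 [w3 [bw hw lm]]]]]]]].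
  exact: normal_form_label bw hw lm.
- exact: label_realized.
- move=> l1 l2 J1 J2 v1 v2 _ _ [w1 [w2 [w3 [bw /reduced_equationsE hw]]]] r2 ne iso.
  have [w1' [w2' [w3' [bw' /reduced_equationsE hw']]]] :=
    isomorphic_reduced_equations iso r2.
  apply: ne; apply: (label_unique v1 v2).
  exact: (normal_form_unique bw bw' hw hw' (valid_label_norm v1)).
Qed.
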